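(* Let $n\ge 3$ and let $M^n$ be an $n$-dimensional complete, connected, smooth Riemannian manifold without boundary, with metric $\langle\,,\rangle$, and suppose $M^n$ is isometric to a Riemannian product $N\times\mathbb{R}$ for some Riemannian manifold $N$. Let $f:M^n\to\mathbb{R}$ be a non-trivial affine function, and let $\alpha:I\subset\mathbb{R}\to M^n$ be a Frenet curve of proper $n$ with Frenet frame $\{V_1,\dots,V_n\}$ and harmonic curvatures $\{H_1,\dots,H_{n-2}\}$. If $\alpha$ is an $f$-eikonal helix curve with axis $\nabla f$, then along $\alpha$ $$\langle V_{i+2},\nabla f\rangle = H_i\,\langle V_1,\nabla f\rangle,\qquad i=1,\dots,n-2 .$$
   Context: A smooth curve $\alpha=\alpha(s):I\to M^n$ ($I\subset\mathbb{R}$ an interval), parametrized by arc length, is a Frenet curve of proper $n$ if there are orthonormal frame fields $\{V_1=\alpha',V_2,\dots,V_n\}$ along $\alpha$ (the Frenet frame) and positive functions $k_1(s),\dots,k_{n-1}(s)$ (the curvatures) with $$\nabla_{\alpha'}V_i=-k_{i-1}V_{i-1}+k_iV_{i+1},\qquad i=1,\dots,n,$$ where $V_0=V_{n+1}=0$ and $\nabla_{\alpha'}$ is the Riemannian (Levi-Civita) connection along $\alpha$. Harmonic curvatures $H_i:I\to\mathbb{R}$ of $\alpha$, $i=1,\dots,n-2$: with the convention $H_0=0$, $$H_1=\frac{k_1}{k_2},\qquad H_i=\frac{1}{k_{i+1}}\left\{V_1[H_{i-1}]+k_iH_{i-2}\right\}\quad(2\le i\le n-2),$$ where $V_1[H]=H'=dH/ds$.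 $\nabla f$ is the gradient of the (differentiable) function $f$: $df(X)=\langle\nabla f,X\rangle$. A Frenet curve $\alpha$ is an $f$-eikonal helix curve, with axis $\nabla f$, if $\|\nabla f\|$ is constant along $\alpha$ and the function $\langle\nabla f,V_1\rangle$ is a non-zero constant along $\alpha$. A function $f:M^n\to\mathbb{R}$ is affine if for every geodesic $\gamma$ of $M^n$ (with affine parameter $t$) the function $t\mapsto f(\gamma(t))$ is of the form $at+b$ with $a,b$ real constants; it is non-trivial if it is not constant. *)

(* Defs.v *)
From HB Require Import structures.
From mathcomp Require Import all_boot all_order all_algebra.
From mathcomp Require Import all_classical all_reals all_analysis.

Set Implicit Arguments.
Unset Strict Implicit.
Unset Printing Implicit Defensive.

Import Order.TTheory GRing.Theory Num.Theory.
Import numFieldNormedType.Exports.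

Local Open Scope classical_set_scope.
Local Open Scope ring_scope.

Section Calculus.
Variable R : realType.

Definition partial n (W : normedModType R) (i : 'I_n)
    (f : 'rV[R]_n -> W) : 'rV[R]_n -> W :=
  fun x => 'D_(delta_mx 0 i) f x.

(* C^oo on an open set U: every iterated partial derivative (the empty one
   included) is Frechet differentiable at every point of U. *)
Definition smooth n (W : normedModType R) (U : set 'rV[R]_n)
    (f : 'rV[R]_n -> W) : Prop :=
  forall (l : seq 'I_n) (x : 'rV[R]_n), U x ->
    differentiable (foldr (@partial n W) f l) x.

(* Derivative relative to an interval I: the two-sided derivative at interior
   points of I, the one-sided derivative at an endpoint belonging to I. *)
Definition diff_quot (W : normedModType R) (u : R -> W) (s : R) : R -> W :=
  fun t => (t - s)^-1 *: (u t - u s).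

Definition derivable_on (W : normedModType R) (I : set R) (u : R -> W)
    (s : R) : Prop :=
  cvg (diff_quot u s @ within I s^').

Definition derive_on (W : normedModType R) (I : set R) (u : R -> W) : R -> W :=
  fun s => lim (diff_quot u s @ within I s^').

Definition nondegenerate_interval (I : set R) : Prop :=
  is_interval I /\ exists a b, [/\ I a, I b & a < b].

End Calculus.

Section Manifold.
Variable R : realType.

(* [chart_map] and [chart_inv] are only meaningful on [chart_dom] and on its
   image; they take arbitrary values elsewhere. *)
Record chart (M : topologicalType) (n : nat) := Chart {
  chart_dom : set M;
  chart_map : M -> 'rV[R]_n;
  chart_inv : 'rV[R]_n -> M }.

Definition chart_img M n (c : @chart M n) : set 'rV[R]_n :=
  chart_map c @` chart_dom c.

(* The data of a Riemannian manifold; its axioms are [riemannian_manifold]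
   below. Each point p carries a preferred chart [chart_at p] of the atlas, and
   T_p M is identified with R^n by the coordinates of that chart; [metric p]
   is the Gram matrix of <,>_p in these coordinates. *)
Record riemannian_data (n : nat) := RiemannianData {
  carrier :> topologicalType;
  atlas : set (chart carrier n);
  chart_at : carrier -> chart carrier n;
  metric : carrier -> 'M[R]_n }.

Definition tangent n (M : riemannian_data n) (p : M) : Type := 'rV[R]_n.

Definition inner n (M : riemannian_data n) (p : M) (u v : tangent p) : R :=
  ((u : 'rV[R]_n) *m metric p *m (v : 'rV[R]_n)^T) 0 0.

Definition coord_at n (M : riemannian_data n) (p : M) : 'rV[R]_n :=
  chart_map (chart_at p) p.

(* Components, in a chart c around p, of the tangent vector v at p. *)
Definition components n (M : riemannian_data n) (c : chart M n) (p : M)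
    (v : tangent p) : 'rV[R]_n :=
  'd (chart_map c \o chart_inv (chart_at p)) (coord_at p) (v : 'rV[R]_n).

(* The i-th coordinate vector field of c at the point with coordinates x. *)
Definition coord_vector n (M : riemannian_data n) (c : chart M n)
    (x : 'rV[R]_n) (i : 'I_n) : tangent (chart_inv c x) :=
  'd (chart_map (chart_at (chart_inv c x)) \o chart_inv c) x
     (delta_mx 0 i : 'rV[R]_n).

(* g_ij in the chart c. *)
Definition gram n (M : riemannian_data n) (c : chart M n) (x : 'rV[R]_n) :
    'M[R]_n :=
  \matrix_(i, j) inner (coord_vector c x i) (coord_vector c x j).

Definition smooth_manifold n (M : riemannian_data n) : Prop :=
  [/\ hausdorff_space M,
      @second_countable M,
      forall p : M, atlas (chart_at p) /\ chart_dom (chart_at p) p,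
      forall c : chart M n, atlas c ->
        [/\ open (chart_dom c),
            open (chart_img c),
            {in chart_dom c, cancel (chart_map c) (chart_inv c)},
            {in chart_dom c, continuous (chart_map c)} &
            {in chart_img c, continuous (chart_inv c)}] &
      forall c d : chart M n, atlas c -> atlas d ->
        smooth (chart_map c @` (chart_dom c `&` chart_dom d))
               (chart_map d \o chart_inv c)].

Definition riemannian_manifold n (M : riemannian_data n) : Prop :=
  [/\ smooth_manifold M,
      forall (p : M) (u v : tangent p), inner u v = inner v u,
      forall (p : M) (v : tangent p), (v : 'rV[R]_n) != 0 -> 0 < inner v v &
      forall c : chart M n, atlas c -> forall i j : 'I_n,
        smooth (chart_img c) (fun x => gram c x i j : R^o)].

Definition smooth_map m n (M : riemannian_data m) (N : riemannian_data n)
    (F : M -> N) : Prop :=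
  continuous F /\
  forall (c : chart M m) (d : chart N n), atlas c -> atlas d ->
    smooth (chart_map c @` (chart_dom c `&` F @^-1` chart_dom d))
           (chart_map d \o F \o chart_inv c).

Definition tangent_map m n (M : riemannian_data m) (N : riemannian_data n)
    (F : M -> N) (p : M) (v : tangent p) : tangent (F p) :=
  'd (chart_map (chart_at (F p)) \o F \o chart_inv (chart_at p)) (coord_at p)
     (v : 'rV[R]_m).

Definition isometric m n (M : riemannian_data m) (N : riemannian_data n) :
    Prop :=
  exists (F : M -> N) (G : N -> M),
    [/\ smooth_map F, smooth_map G, cancel F G, cancel G F &
        forall (p : M) (u v : tangent p),
          inner (tangent_map F u) (tangent_map F v) = inner u v].

Definition prod_chart (M N : topologicalType) m n (c : chart M m)
    (d : chart N n) : chart (M * N)%type (m + n) :=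
  {| chart_dom := chart_dom c `*` chart_dom d;
     chart_map := fun p => row_mx (chart_map c p.1) (chart_map d p.2);
     chart_inv := fun x => (chart_inv c (lsubmx x), chart_inv d (rsubmx x)) |}.

Definition riemannian_prod m n (M : riemannian_data m)
    (N : riemannian_data n) : riemannian_data (m + n) :=
  {| carrier := (M * N)%type;
     atlas := [set e | exists c d,
       [/\ atlas c, atlas d & e = @prod_chart M N m n c d]];
     chart_at := fun p => prod_chart (chart_at p.1) (chart_at p.2);
     metric := fun p => block_mx (metric p.1) 0 0 (metric p.2) |}.

Definition line_chart : chart R 1 :=
  {| chart_dom := setT;
     chart_map := fun t => const_mx t;
     chart_inv := fun x => x 0 0 |}.

Definition real_line : riemannian_data 1 :=
  {| carrier := R;
     atlas := [set line_chart];
     chart_at := fun=> line_chart;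
     metric := fun=> 1%:M |}.

End Manifold.

Section Curves.
Variables (R : realType) (n : nat) (M : riemannian_data R n).

Definition smooth_curve (I : set R) (a : R -> M) : Prop :=
  {within I, continuous a} /\
  forall (c : chart R M n), atlas c -> forall (k : nat) (s : R),
    I s -> chart_dom c (a s) ->
    derivable_on I (iter k (derive_on I) (chart_map c \o a)) s.

Definition velocity (I : set R) (a : R -> M) (s : R) : tangent (a s) :=
  derive_on I (chart_map (chart_at (a s)) \o a) s.

Definition field_along (a : R -> M) : Type := forall s : R, tangent (a s).

Definition smooth_field (I : set R) (a : R -> M) (V : field_along a) : Prop :=
  forall (c : chart R M n), atlas c -> forall (k : nat) (s : R),
    I s -> chart_dom c (a s) ->
    derivable_on I (iter k (derive_on I) (fun t => components c (V t))) s.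

(* Gamma^k_ij = 1/2 g^kl (d_i g_jl + d_j g_il - d_l g_ij): the coefficients of
   the Levi-Civita connection in the chart c. *)
Definition christoffel (c : chart R M n) (x : 'rV[R]_n) (i j k : 'I_n) : R :=
  let dg (h p q : 'I_n) : R :=
    @partial R n R^o h (fun y => gram c y p q) x in
  2^-1 * \sum_l invmx (gram c x) k l * (dg i j l + dg j i l - dg l i j).

(* The Levi-Civita covariant derivative along a,
   (nabla_{a'} V)^k = (V^k)' + Gamma^k_ij (x^i)' V^j,
   computed at a s in the preferred chart there. *)
Definition cov_derive (I : set R) (a : R -> M) (V : field_along a) :
    field_along a :=
  fun s =>
    let c := chart_at (a s) in
    let v : 'rV[R]_n := components c (V s) in
    let a' : 'rV[R]_n := velocity I a s in
    derive_on I (fun t => components c (V t)) s +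
    \row_k \sum_i \sum_j christoffel c (coord_at (a s)) i j k * a' 0 i * v 0 j.

Definition geodesic (I : set R) (a : R -> M) : Prop :=
  smooth_curve I a /\
  forall s, I s -> cov_derive I (velocity I a) s = (0 : 'rV[R]_n).

(* Geodesic completeness: exp_p is defined on all of T_p M, for every p. *)
Definition complete_manifold : Prop :=
  forall (p : M) (v : tangent p), exists a : R -> M,
    [/\ geodesic setT a, a 0 = p & velocity setT a 0 = v :> 'rV[R]_n].

Definition differentiable_fun (f : M -> R) : Prop :=
  forall p : M,
    differentiable (f \o chart_inv (chart_at p) : _ -> R^o) (coord_at p).

Definition differential (f : M -> R) (p : M) (v : tangent p) : R :=
  'd (f \o chart_inv (chart_at p) : _ -> R^o) (coord_at p) (v : 'rV[R]_n).

Definition is_gradient (f : M -> R) (gradf : forall p : M, tangent p) : Prop :=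
  differentiable_fun f /\
  forall (p : M) (v : tangent p), differential f v = inner (gradf p) v.

Definition affine_fun (f : M -> R) : Prop :=
  forall (J : set R) (a : R -> M),
    nondegenerate_interval J -> geodesic J a ->
    exists u v : R, forall t, J t -> f (a t) = u * t + v.

Definition nontrivial_fun (f : M -> R) : Prop :=
  ~ exists b : R, forall p : M, f p = b.

(* The fields V_1, ..., V_n and the curvatures k_1, ..., k_(n-1) are indexed
   from 1; the values of V and k at other indices are irrelevant. *)
Definition frenet_curve (I : set R) (a : R -> M) (V : nat -> field_along a)
    (k : nat -> R -> R) : Prop :=
  [/\ smooth_curve I a /\
        (forall s, I s -> inner (velocity I a s) (velocity I a s) = 1),
      forall i, (1 <= i <= n)%N -> smooth_field I (V i),
      (forall s, I s -> V 1%N s = velocity I a s) /\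
        (forall i j s, (1 <= i <= n)%N -> (1 <= j <= n)%N -> I s ->
           inner (V i s) (V j s) = (i == j)%:R),
      forall i s, (1 <= i <= n.-1)%N -> I s -> 0 < k i s &
      forall i s, (1 <= i <= n)%N -> I s ->
        cov_derive I (V i) s =
          (if i == 1%N then 0 else - k i.-1 s *: (V i.-1 s : 'rV[R]_n)) +
          (if i == n then 0 else k i s *: (V i.+1 s : 'rV[R]_n))].

Fixpoint harmonic_curvature (I : set R) (k : nat -> R -> R) (i : nat) :
    R -> R :=
  match i with
  | 0 => fun=> 0
  | 1 => fun s => k 1%N s / k 2%N s
  | (j.+1 as i').+1 => fun s =>
      (k i.+1 s)^-1 *
      (@derive_on R R^o I (harmonic_curvature I k i') s +
       k i s * harmonic_curvature I k j s)
  end.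

Definition eikonal_helix (I : set R) (a : R -> M) (V1 : field_along a)
    (gradf : forall p : M, tangent p) : Prop :=
  (exists r : R, forall s, I s ->
     Num.sqrt (inner (gradf (a s)) (gradf (a s))) = r) /\
  (exists2 c : R, c != 0 & forall s, I s -> inner (gradf (a s)) (V1 s) = c).

End Curves.

(* Main.v *)
Require Import Defs.
From HB Require Import structures.
From mathcomp Require Import all_boot all_order all_algebra.
From mathcomp Require Import all_classical all_reals all_analysis.
From mathcomp Require Import ring lra zify.

(** Let [c_i] be the function [<V_i, grad f>] along the curve.  If [grad f] is
parallel, the Frenet equations give
[c_i' = - k_(i-1) c_(i-1) + k_i c_(i+1)].  Since [c_1] is constant, [c_2 = 0];
since [c_2] is constant, [c_3 = (k_1 / k_2) c_1]; and solving for the last term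
of the next equations is, after division by [c_1], exactly the recursion that
defines the harmonic curvatures ([frenet_recursion]).

The substance is that [grad f] is parallel, or that the Hessian of [f]
vanishes, although [f] is only known to be differentiable.  Reading
off the smoothness of [f] in normal coordinates would require smooth dependence
of geodesics on their initial data; the following bootstrap uses only the
existence of geodesics (completeness) and a priori estimates.  Let [F] be [f]
in a chart and [G] the bilinear map given by the Christoffel symbols at [x0].
A geodesic issuing from [x] with small velocity [v] is, at time 1, at a point
[z = x + v - G(v, v) / 2 + o(|v|^2)], uniformly for [x] near [x0]
([geodesic_endpoint]), and affinity says [F z = F x + dF_x v] with no error
term ([affine_geodesic_expansion]).  From these two facts
[geodesically_affine_hessian] derives in turn: [F] is bounded near [x0], so
[dF] is bounded, so [F] is Lipschitz and [F (x + v) - F x - dF_x v] is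
[O(|v|^2)], so [dF] is Lipschitz at [x0], so
[F (x + v) = F x + dF_x v + dF_x0 (G(v, v)) / 2 + o(|v|^2)] uniformly, and
finally [dF w] is differentiable at [x0] with derivative
[h |-> dF_x0 (G(h, w))], which is the vanishing of the Hessian.  Consequently
the derivative of [df (V)] along a curve is [df] of the covariant derivative
of [V] ([affine_differential_along]).

The geodesic equation is imposed, at each time, in the preferred chart of the
current point, whereas the estimates live in one chart.  The passage between
the two is the transformation law of the Christoffel symbols
([christoffel_map_transition]), which follows from the Koszul formula, the
change of variables in the Gram matrix and the symmetry of second derivatives
([clairaut]). *)

Set Implicit Arguments.
Unset Strict Implicit.
Unset Printing Implicit Defensive.

Import Order.TTheory GRing.Theory Num.Theory.
Import numFieldNormedType.Exports.

Local Open Scope classical_set_scope.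
Local Open Scope ring_scope.

(** * Differentials and relative derivatives of curves *)

Section Differentials.
Variables (R : realType) (V W : normedModType R).

Lemma differential_bound (f : V -> W) (x : V) : differentiable f x ->
  forall e, 0 < e ->
  \forall y \near x, `|f y - f x - 'd f x (y - x)| <= e * `|y - x|.
Proof.
move=> fD e e0.
have /eqaddoP /(_ e e0) H := diff_locally fD.
rewrite (near_shift 0 x) subr0.
near=> h.
have : `|(f \o shift x - (cst (f x) + 'd f x)) h| <= e * `|h| by near: h.
by rewrite /= addrK !fctE opprD addrA.
Unshelve. all: by end_near. Qed.

(** The converse of [differential_bound]: the pair of lemmas replaces the
    little-o calculus by plain inequalities in the sequel. *)
Lemma differential_char (f : V -> W) (x : V) (L : {linear V -> W}) :
  continuous L ->
  (forall e, 0 < e ->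
    \forall y \near x, `|f y - f x - L (y - x)| <= e * `|y - x|) ->
  differentiable f x /\ 'd f x = L :> (V -> W).
Proof.
move=> Lc H.
have E : f \o shift x = cst (f x) + L +o_ 0 id.
  apply/eqaddoP => e e0.
  move: (H e e0); rewrite (near_shift 0 x) subr0 => H'.
  near=> h.
  have : `|(f \o shift x) h - f x - L ((shift x) h - x)| <= e * `|shift x h - x|.
    by near: h.
  by rewrite /= addrK !fctE opprD addrA.
have LE := diff_unique Lc E; split => //.
apply/diff_locallyP; split; first by rewrite LE.
by rewrite LE; exact: E.
Unshelve. all: by end_near. Qed.
End Differentials.

Section OneVariable.
Variable R : realType.
Implicit Types (I : set R) (s : R).

(** The value is part of the relation because [derive_on] is defined by a
    total limit, which is meaningless where the derivative does not exist. *)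
Definition has_deriv (W : normedModType R) I (u : R -> W) s (l : W) : Prop :=
  diff_quot u s @ within I s^' --> l.

(** First-order approximation makes sense at the base point itself, so the
    punctured filter disappears. *)
Lemma has_derivP (W : normedModType R) I (u : R -> W) s (l : W) :
  has_deriv I u s l <->
  forall e, 0 < e ->
    \forall t \near s, I t -> `|u t - u s - (t - s) *: l| <= e * `|t - s|.
Proof.
split=> [/cvgrPdist_le H e e0|H].
  have {}H := H e e0; rewrite !near_withinE in H.
  near=> t => It.
  have [->|ts] := eqVneq t s.
    by rewrite !subrr scale0r subr0 !normr0 mulr0.
  have ts0 : t - s != 0 by rewrite subr_eq0.
  have -> : u t - u s - (t - s) *: l =
      (t - s) *: - (l - (t - s)^-1 *: (u t - u s)).
    by rewrite opprB scalerBr scalerA divff// scale1r.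
  rewrite normrZ mulrC ler_pM2r ?normr_gt0// normrN.
  by move: It; move: ts; near: t.
apply/cvgrPdist_le => e e0; rewrite !near_withinE.
near=> t => ts It.
have ts0 : t - s != 0 by rewrite subr_eq0.
rewrite -(@ler_pM2r _ `|t - s|) ?normr_gt0//.
rewrite mulrC -normrZ scalerBr /diff_quot scalerA divff// scale1r -normrN opprB.
by move: It; near: t; exact: H.
Unshelve. all: by end_near. Qed.

Lemma has_deriv_ext (W : normedModType R) I (u v : R -> W) s (l : W) :
  u s = v s -> (\forall t \near s, I t -> u t = v t) ->
  has_deriv I u s l -> has_deriv I v s l.
Proof.
move=> uvs uv /has_derivP H; apply/has_derivP => e e0.
near=> t => It; rewrite -uvs.
have <- : u t = v t by move: It; near: t.
by move: It; near: t; exact: H.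
Unshelve. all: by end_near. Qed.

Lemma has_deriv_comp (V W : normedModType R) I (u : R -> V) s (l : V)
    (f : V -> W) :
  has_deriv I u s l -> differentiable f (u s) ->
  has_deriv I (f \o u) s ('d f (u s) l).
Proof.
move=> /has_derivP H fD.
have Lc : continuous ('d f (u s)) by exact: diff_continuous.
have [k k0 kL] := linear_lipschitz Lc.
apply/has_derivP => e e0.
pose e1 := e / (2 * (`|l| + 1)).
have l1 : 0 < `|l| + 1 by rewrite ltr_wpDl.
have e10 : 0 < e1 by rewrite divr_gt0// mulr_gt0.
(* The bound 1 controls the increment of [u], the other the image of the
   error under the differential. *)
pose e2 := Num.min 1 (e / (2 * k)).
have e20 : 0 < e2 by rewrite lt_min ltr01 divr_gt0// mulr_gt0.
have ucont : \forall t \near s, I t ->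
    `|f (u t) - f (u s) - 'd f (u s) (u t - u s)| <= e1 * `|u t - u s|.
  have /nbhs_ballP[r /= r0 rH] := differential_bound fD e10.
  near=> t => It; apply: rH; rewrite -ball_normE /=.
  have H1 : `|u t - u s - (t - s) *: l| <= 1 * `|t - s|.
    by move: It; near: t; exact: H.
  rewrite distrC -[u t - u s](subrK ((t - s) *: l)).
  apply: le_lt_trans (ler_normD _ _) _.
  rewrite normrZ; apply: le_lt_trans (lerD H1 (lexx _)) _.
  rewrite mulrC -mulrDr [1 + _]addrC -ltr_pdivlMr//.
  near: t; have r1 : 0 < r / (`|l| + 1) by rewrite divr_gt0.
  apply: filterS (nbhsx_ballx s _ r1) => t.
  by rewrite -ball_normE /= distrC.
near=> t => It.
have H1 : `|u t - u s - (t - s) *: l| <= e2 * `|t - s|.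
  by move: It; near: t; exact: H.
have H2 : `|f (u t) - f (u s) - 'd f (u s) (u t - u s)| <= e1 * `|u t - u s|.
  by move: It; near: t.
have -> : (f \o u) t - (f \o u) s - (t - s) *: 'd f (u s) l =
  (f (u t) - f (u s) - 'd f (u s) (u t - u s)) +
  'd f (u s) (u t - u s - (t - s) *: l).
  rewrite (linearB ('d f (u s)) _ ((t - s) *: l)).
  by rewrite (linearZZ ('d f (u s)))/= addrA subrK.
apply: le_trans (ler_normD _ _) _.
have H3 : `|u t - u s| <= (`|l| + 1) * `|t - s|.
  rewrite -[u t - u s](subrK ((t - s) *: l)).
  apply: le_trans (ler_normD _ _) _.
  rewrite normrZ mulrDl mul1r addrC mulrC lerD2l//.
  by rewrite (le_trans H1)// ler_piMl// ge_min lexx.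
have H4 : `|'d f (u s) (u t - u s - (t - s) *: l)| <= e / 2 * `|t - s|.
  apply: le_trans (kL _) _.
  apply: le_trans (ler_wpM2l (ltW k0) H1) _.
  rewrite mulrA ler_wpM2r//.
  rewrite -ler_pdivlMl// ge_min; apply/orP; right.
  by rewrite invfM mulrC; lra.
have H5 : e1 * `|u t - u s| <= e / 2 * `|t - s|.
  apply: le_trans (ler_wpM2l (ltW e10) H3) _.
  rewrite mulrA ler_wpM2r// /e1 invfM !mulrA.
  by rewrite divfK// gt_eqF.
by apply: le_trans (lerD (le_trans H2 H5) H4) _; rewrite -mulrDl -splitr.
Unshelve. all: by end_near. Qed.

(** A point of a nondegenerate interval is a limit of other points of the
    interval, possibly on one side only; this is what makes relative
    derivatives unique. *)
Lemma within_dnbhs_proper I s : nondegenerate_interval I -> I s ->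
  ProperFilter (within I s^').
Proof.
move=> [itvI [a [b [Ia Ib ab]]]] Is; apply: Build_ProperFilter_ex => P.
rewrite /within /= => /nbhs_ballP[r /= r0 rP].
have [sb|bs] := ltP s b.
  have H : s < Num.min (s + r / 2) b by rewrite lt_min sb andbT ltrDl divr_gt0.
  exists (Num.min (s + r / 2) b); apply: rP.
  - rewrite -ball_normE /= distrC gtr0_norm ?subr_gt0// ltrBlDl.
    by rewrite gt_min ltrD2l; apply/orP; left; rewrite ltr_pdivrMr// ltr_pMr// ltr1n.
  - by rewrite gt_eqF.
  - by apply: (itvI s b) => //; rewrite (ltW H)/= ge_min lexx orbT.
have {ab bs} as_ := lt_le_trans ab bs.
have H : Num.max (s - r / 2) a < s.
  by rewrite gt_max as_ andbT gtrDl oppr_lt0 divr_gt0.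
exists (Num.max (s - r / 2) a); apply: rP.
- rewrite -ball_normE /= gtr0_norm ?subr_gt0// ltrBlDr -ltrBlDl.
  rewrite lt_max ltrD2l; apply/orP; left.
  by rewrite ltrN2 ltr_pdivrMr// ltr_pMr// ltr1n.
- by rewrite lt_eqF.
- by apply: (itvI a s) => //; rewrite (ltW H)/= le_max lexx orbT.
Qed.

Lemma derive_on_unique (W : normedModType R) I (u : R -> W) s (l : W) :
  nondegenerate_interval I -> I s -> has_deriv I u s l -> derive_on I u s = l.
Proof.
move=> nI Is H; have PF := within_dnbhs_proper nI Is.
by apply: cvg_lim => //; exact: norm_hausdorff.
Qed.

Lemma has_deriv_cst (W : normedModType R) I s (c : W) :
  has_deriv I (fun=> c) s 0.
Proof.
apply/has_derivP => e e0; near=> t => _.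
by rewrite subrr scaler0 subr0 normr0 mulr_ge0// ltW.
Unshelve. all: by end_near. Qed.

Lemma has_derivD (W : normedModType R) I (u v : R -> W) s (l m : W) :
  has_deriv I u s l -> has_deriv I v s m ->
  has_deriv I (fun t => u t + v t) s (l + m).
Proof.
move=> ul vm; rewrite /has_deriv.
have -> : diff_quot (fun t => u t + v t) s = diff_quot u s \+ diff_quot v s.
  by apply/funext => t; rewrite /diff_quot /= -scalerDr opprD addrACA.
exact: cvgD.
Qed.

Lemma has_derivN (W : normedModType R) I (u : R -> W) s (l : W) :
  has_deriv I u s l -> has_deriv I (fun t => - u t) s (- l).
Proof.
move=> ul; rewrite /has_deriv.
have -> : diff_quot (fun t => - u t) s = \- diff_quot u s.
  by apply/funext => t; rewrite /diff_quot /= -opprD scalerN.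
exact: cvgN.
Qed.

Lemma has_deriv_sum (W : normedModType R) I n (u : 'I_n -> R -> W) s
    (l : 'I_n -> W) :
  (forall i, has_deriv I (u i) s (l i)) ->
  has_deriv I (fun t => \sum_i u i t) s (\sum_i l i).
Proof.
elim: n u l => [|n IH] u l H.
  rewrite big_ord0; have -> : (fun t => \sum_(i < 0) u i t) = fun=> 0.
    by apply/funext => t; rewrite big_ord0.
  exact: has_deriv_cst.
rewrite big_ord_recl; have -> : (fun t => \sum_(i < n.+1) u i t) =
    (fun t => u ord0 t + \sum_(i < n) u (lift ord0 i) t).
  by apply/funext => t; rewrite big_ord_recl.
by apply: has_derivD => //; exact: IH.
Qed.

Lemma has_deriv_continuous (W : normedModType R) I (u : R -> W) s (l : W) :
  has_deriv I u s l -> u t @[t --> within I s^'] --> u s.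
Proof.
move=> ul.
have -> : u = fun t => u s + (t - s) *: diff_quot u s t.
  apply/funext => t; rewrite /diff_quot scalerA.
  have [->|ts] := eqVneq t s; first by rewrite !subrr mul0r scale0r addr0.
  by rewrite divff ?subr_eq0// scale1r addrC subrK.
rewrite /= subrr scale0r -[X in _ --> X]/(u s + 0).
apply: cvgD; first exact: cvg_cst.
rewrite -(scale0r l); apply: cvgZ => //.
rewrite -(subrr s); apply: cvgB; last exact: cvg_cst.
by apply: cvg_trans; [exact: cvg_within|exact: cvg_within].
Qed.

Lemma has_derivZ (W : normedModType R) I (u : R -> R^o) (v : R -> W) s
    (l : R^o) (m : W) :
  has_deriv I u s l -> has_deriv I v s m ->
  has_deriv I (fun t => (u t : R) *: v t) s ((l : R) *: v s + (u s : R) *: m).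
Proof.
move=> ul vm; rewrite /has_deriv.
have -> : diff_quot (fun t => (u t : R) *: v t) s =
   (fun t => (diff_quot u s t : R) *: v s + (u t : R) *: diff_quot v s t).
  apply/funext => t.
  have -> : diff_quot u s t = (t - s)^-1 * (u t - u s) :> R by [].
  have -> : (u t : R) *: diff_quot v s t = (t - s)^-1 *: ((u t : R) *: (v t - v s)).
    by rewrite /diff_quot !scalerA mulrC.
  rewrite /diff_quot -scalerA -scalerDr; congr (_ *: _).
  by rewrite scalerBl scalerBr [RHS]addrC addrA subrK.
apply: cvgD; first by apply: cvgZ => //; exact: cvg_cst.
by apply: cvgZ => //; exact: (has_deriv_continuous ul).
Qed.

Lemma has_derivM I (u v : R -> R^o) s (l m : R^o) :
  has_deriv I u s l -> has_deriv I v s m ->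
  has_deriv I (fun t => u t * v t : R^o) s (l * v s + u s * m).
Proof. exact: has_derivZ. Qed.

Lemma has_deriv_coord n I (u : R -> 'rV[R]_n) s l j :
  has_deriv I u s l -> has_deriv I (fun t => u t 0 j : R^o) s (l 0 j).
Proof.
move=> ul; rewrite /has_deriv.
have -> : diff_quot (fun t => u t 0 j : R^o) s = fun t => (diff_quot u s t) 0 j.
  by apply/funext => t; rewrite /diff_quot !mxE.
apply: (@cvg_comp _ _ _ (diff_quot u s) (fun N : 'rV[R]_n => N 0 j)) ul _.
exact: coord_continuous.
Qed.

Lemma has_deriv_setT_is_derive (W : normedModType R) (u : R -> W) s l :
  has_deriv setT u s l -> is_derive s 1 u l.
Proof.
move=> H.
have E : (fun h => h^-1 *: ((u \o shift s) (h *: 1) - u s)) @ 0^' --> l.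
  apply/cvgrPdist_le => e e0; move/has_derivP : H => /(_ e e0) H.
  rewrite near_withinE; rewrite (near_shift 0 s) subr0 in H.
  near=> h => h0.
  have : setT ((shift s) h) ->
      `|u ((shift s) h) - u s - (shift s h - s) *: l| <= e * `|shift s h - s|.
    by near: h.
  move/(_ Logic.I); rewrite /= addrK => H1.
  rewrite /GRing.scale/= mulr1 -(@ler_pM2r _ `|h|) ?normr_gt0//.
  by rewrite mulrC -normrZ scalerBr scalerA divff// scale1r -normrN opprB.
apply: DeriveDef; first by apply/cvg_ex; exists l.
by apply: cvg_lim => //; exact: norm_hausdorff.
Unshelve. all: by end_near. Qed.

Lemma has_deriv_setT_continuous (W : normedModType R) (u : R -> W) s (l : W) :
  has_deriv setT u s l -> {for s, continuous u}.
Proof.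
move=> ul; apply: differentiable_continuous; apply/derivable1_diffP.
by have [] := has_deriv_setT_is_derive ul.
Qed.

Lemma mean_value_bound (g dg : R -> R^o) (a b C : R) : a <= b ->
  (forall t, a <= t <= b -> has_deriv setT g t (dg t)) ->
  (forall t, a <= t <= b -> `|dg t| <= C) ->
  `|g b - g a| <= C * (b - a).
Proof.
move=> ab gd gC.
have [||c] := @MVT_segment R g dg a b ab.
- move=> x; rewrite in_itv /= => /andP[ax xb].
  by apply: has_deriv_setT_is_derive; apply: gd; rewrite !ltW.
- apply: continuous_in_subspaceT => x; rewrite inE /= in_itv /= => xab.
  exact: (has_deriv_setT_continuous (gd x xab)).
rewrite in_itv /= => cab ->; rewrite normrM (ger0_norm (_ : 0 <= b - a)) ?subr_ge0//.
by rewrite ler_wpM2r ?subr_ge0// gC.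
Qed.

Lemma ler_rV_norm n (v : 'rV[R]_n) C : 0 <= C ->
  (`|v| <= C <-> forall j, `|v 0 j| <= C).
Proof.
move=> C0; rewrite -[`|v|]/(mx_norm v) mx_normrE; split=> [H j|H].
  by apply: le_trans H; apply/bigmax_geP; right; exists (0, j).
by apply/bigmax_leP; split => [//|[i j] _ /=]; rewrite (ord1 i).
Qed.

(** The norm is the maximum of the coordinates, so the vector inequality
    reduces to the scalar one without loss of a constant. *)
Lemma mean_value_bound_rV n (g dg : R -> 'rV[R]_n) (a b C : R) :
  a <= b -> 0 <= C ->
  (forall t, a <= t <= b -> has_deriv setT g t (dg t)) ->
  (forall t, a <= t <= b -> `|dg t| <= C) ->
  `|g b - g a| <= C * (b - a).
Proof.
move=> ab C0 gd gC; have ba : 0 <= b - a by rewrite subr_ge0.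
apply/ler_rV_norm => [|j]; first exact: mulr_ge0.
rewrite !mxE.
apply: (@mean_value_bound (fun t => g t 0 j) (fun t => dg t 0 j)) => // t tab.
  by apply: has_deriv_coord; exact: gd.
by move: j; apply/ler_rV_norm => //; exact: gC.
Qed.

Lemma has_deriv_line (V : normedModType R) I (x h : V) s :
  has_deriv I (fun t => x + t *: h) s h.
Proof.
apply/has_derivP => e e0; near=> t => _.
rewrite opprD addrACA subrr add0r -scalerBl subrr normr0.
by rewrite mulr_ge0// ltW.
Unshelve. all: by end_near. Qed.

(** The product rule for [A G B^T]; applied to Gram matrices in
    coordinates that move with [t]. *)
Lemma derivative_form n I (A B : R -> 'rV[R]_n) (A' B' : 'rV[R]_n)
    (G : R -> 'M[R]_n) (G' : 'M[R]_n) s :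
  has_deriv I A s A' -> has_deriv I B s B' ->
  (forall i j, has_deriv I (fun t => G t i j : R^o) s (G' i j)) ->
  has_deriv I (fun t => (A t *m G t *m (B t)^T) 0 0 : R^o) s
    ((A' *m G s *m (B s)^T) 0 0 + (A s *m G' *m (B s)^T) 0 0 +
     (A s *m G s *m B'^T) 0 0).
Proof.
move=> hA hB hG.
have E u v (H : 'M[R]_n) : (u *m H *m v^T) 0 0 =
    \sum_j (\sum_i u 0 i * H i j) * v 0 j.
  by rewrite mxE; apply: eq_bigr => j _; rewrite !mxE.
have -> : (fun t => (A t *m G t *m (B t)^T) 0 0 : R^o) =
    (fun t => \sum_j (\sum_i A t 0 i * G t i j) * B t 0 j).
  by apply/funext => t; rewrite E.
rewrite !E -!big_split /=; apply: has_deriv_sum => j.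
rewrite -mulrDl -big_split; apply: has_derivM; last exact: has_deriv_coord.
apply: has_deriv_sum => i.
by apply: has_derivM => //; exact: has_deriv_coord.
Qed.

Lemma derivative_form_cst n I (u v : 'rV[R]_n) (G : R -> 'M[R]_n)
    (G' : 'M[R]_n) s :
  (forall i j, has_deriv I (fun t => G t i j : R^o) s (G' i j)) ->
  has_deriv I (fun t => (u *m G t *m v^T) 0 0 : R^o) s ((u *m G' *m v^T) 0 0).
Proof.
move=> hG.
have := derivative_form (has_deriv_cst I s u) (has_deriv_cst I s v) hG.
have -> : ((0 : 'rV[R]_n) *m G s *m v^T) 0 0 = 0 by rewrite !mul0mx mxE.
have -> : (u *m G s *m (0 : 'rV[R]_n)^T) 0 0 = 0 by rewrite trmx0 mulmx0 mxE.
by rewrite add0r addr0.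
Qed.

End OneVariable.

(** * Functions affine along approximate geodesics *)

Section SecondOrder.
Variables (R : realType) (V : normedModType R).

(** If [F] has a second-order expansion with remainder [K |v|^2] at all points
    near [x0], then the increment of its first-order part is [b] up to a
    multiple of [K].  Expand [F (x0 + h + w)] from [x0] and from [x0 + h], and
    [F (x0 + h)] from [x0]: all terms cancel but [D (x0 + h) w - D x0 w - b h w].
    Rescaling [w] to the length of [h] makes all three remainders comparable.
    With [b = 0] and [K] fixed this bounds the variation of [dF]; with [K]
    arbitrarily small it differentiates [dF]. *)
Lemma differential_increment (F : V -> R) (x0 : V) (D : V -> V -> R)
    (b : V -> V -> R) (K d : R) :
  0 <= K ->
  (forall x v w, D x (v + w) = D x v + D x w) ->
  (forall x r v, D x (r *: v) = r * D x v) ->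
  (forall u v w, b (u + v) w = b u w + b v w) ->
  (forall r v w, b (r *: v) w = r * b v w) ->
  (forall v w, b v w = b w v) ->
  (forall x v, `|x - x0| < d -> `|v| < d ->
    `|F (x + v) - F x - D x v - 2^-1 * b v v| <= K * `|v| ^+ 2) ->
  forall h w, `|h| < d / 2 ->
    `|D (x0 + h) w - D x0 w - b h w| <= 6 * K * `|h| * `|w|.
Proof.
move=> K0 DD DZ bD bZ bC H h w hd.
have bZr r u v : b u (r *: v) = r * b u v by rewrite bC bZ bC.
have D0 x : D x 0 = 0 by rewrite -(scale0r (0 : V)) DZ mul0r.
have b0 v : b 0 v = 0 by rewrite -(scale0r (0 : V)) bZ mul0r.
have [->|w0] := eqVneq w 0.
  by rewrite !D0 bC b0 !subrr !normr0 mulr0.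
have [->|h0] := eqVneq h 0.
  by rewrite addr0 b0 !subrr !normr0 mulr0 mul0r.
have wp : 0 < `|w| by rewrite normr_gt0.
have hp : 0 < `|h| by rewrite normr_gt0.
(* [r *: w] has the length of [h]. *)
pose r := `|h| / `|w|; have r0 : 0 < r by rewrite divr_gt0.
have rw : `|r *: w| = `|h|.
  by rewrite normrZ (gtr0_norm r0) /r divfK// gt_eqF.
have hd' : `|h| < d by apply: (lt_trans hd); move: hd hp; lra.
have hrw : `|h + r *: w| <= 2 * `|h|.
  by apply: le_trans (ler_normD _ _) _; rewrite rw mulrDl mul1r.
have E1 := H (x0 + h) (r *: w); rewrite addrAC subrr add0r rw in E1.
have {}E1 := E1 hd' hd'.
have E2 := H x0 (h + r *: w); rewrite subrr normr0 in E2.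
have {}E2 := E2 (lt_trans hp hd').
have {}E2 : `|F (x0 + (h + r *: w)) - F x0 - D x0 (h + r *: w) -
    2^-1 * b (h + r *: w) (h + r *: w)| <= K * (4 * `|h| ^+ 2).
  apply: le_trans (E2 _) _; first by apply: le_lt_trans hrw _; move: hd; lra.
  rewrite ler_wpM2l// (_ : 4 * `|h| ^+ 2 = (2 * `|h|) ^+ 2); last by ring.
  by rewrite lerXn2r// nnegrE// mulr_ge0.
have E3 := H x0 h; rewrite subrr normr0 in E3.
have {}E3 := E3 (lt_trans hp hd') hd'.
rewrite -(ler_pM2l r0) -{1}(gtr0_norm r0) -normrM.
have -> : r * (D (x0 + h) w - D x0 w - b h w) =
  (F (x0 + (h + r *: w)) - F x0 - D x0 (h + r *: w) -
    2^-1 * b (h + r *: w) (h + r *: w)) -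
  (F (x0 + h) - F x0 - D x0 h - 2^-1 * b h h) -
  (F (x0 + h + r *: w) - F (x0 + h) - D (x0 + h) (r *: w) -
     2^-1 * b (r *: w) (r *: w)).
  rewrite !addrA !DD !DZ !bD (bC h (h + _)) (bC (r *: w) (h + _)) !bD !bZ !bZr.
  by rewrite (bC w h); field.
have -> : r * (6 * K * `|h| * `|w|) = 6 * K * `|h| ^+ 2.
  by rewrite /r expr2; field; rewrite gt_eqF.
apply: le_trans (ler_normB _ _) _.
apply: le_trans (lerD (ler_normB _ _) (lexx _)) _.
by apply: le_trans (lerD (lerD E2 E3) E1) _; lra.
Qed.

(** The intermediate point is no farther from [x0] than the ends, so estimates
    that hold on a ball around [x0] apply to it. *)
Lemma mean_value_segment (F : V -> R^o) (x0 x y : V) (r : R) :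
  (forall z, `|z - x0| < r -> differentiable F z) ->
  `|x - x0| < r -> `|y - x0| < r ->
  exists2 z, `|z - x0| <= Num.max `|x - x0| `|y - x0| &
    F y - F x = 'd F z (y - x).
Proof.
move=> FD xr yr.
pose p (t : R) := x + t *: (y - x).
have pE (t : R) : p t - x0 = (1 - t) *: (x - x0) + t *: (y - x0).
  have -> : p t = x + t *: (y - x0 - (x - x0)) by rewrite opprB addrA subrK.
  by rewrite scalerBr scalerBl scale1r addrAC [_ *: (y - _) - _]addrC addrA.
have pb (t : R) : 0 <= t <= 1 -> `|p t - x0| <= Num.max `|x - x0| `|y - x0|.
  move=> /andP[t0 t1]; rewrite pE; apply: le_trans (ler_normD _ _) _.
  rewrite !normrZ (ger0_norm t0) (@ger0_norm _ (1 - t)) ?subr_ge0//.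
  set m := Num.max _ _; have -> : m = (1 - t) * m + t * m by ring.
  by rewrite lerD// ler_wpM2l ?subr_ge0// le_max lexx ?orbT.
have mr : Num.max `|x - x0| `|y - x0| < r by rewrite gt_max xr.
have pder (t : R) : 0 <= t <= 1 -> is_derive t 1 (F \o p) ('d F (p t) (y - x)).
  move=> t01; apply: has_deriv_setT_is_derive.
  apply: has_deriv_comp; last by apply: FD; apply: le_lt_trans (pb _ t01) mr.
  apply/has_derivP => e e0; near=> s => _.
  rewrite /p opprD addrACA subrr add0r -scalerBl subrr normr0.
  by rewrite mulr_ge0// ltW.
have [||c] := @MVT_segment R (F \o p) (fun t => 'd F (p t) (y - x)) 0 1 ler01.
- move=> t; rewrite in_itv /= => /andP[t0 t1]; apply: pder.
  by rewrite !ltW.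
- apply: continuous_in_subspaceT => t; rewrite inE /= in_itv /= => t01.
  apply: differentiable_continuous; apply/derivable1_diffP.
  by have [] := pder t t01.
rewrite in_itv /= => c01; rewrite /= subr0 mulr1 /p scale1r scale0r addr0.
rewrite [x + (y - x)]addrC subrK => E.
by exists (p c) => //; exact: pb.
Unshelve. all: by end_near. Qed.
End SecondOrder.

Section GeodesicallyAffine.
Variables (R : realType) (V : normedModType R).
Variables (F : V -> R^o) (x0 : V) (rho C : R) (G : V -> V -> V).
Hypotheses (rho0 : 0 < rho) (C0 : 0 <= C).
Hypothesis FD : forall x, `|x - x0| < rho -> differentiable F x.
Hypothesis GD : forall u v w, G (u + v) w = G u w + G v w.
Hypothesis GZ : forall r v w, G (r *: v) w = r *: G v w.
Hypothesis GC : forall v w, G v w = G w v.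
Hypothesis GB : forall v w, `|G v w| <= C * `|v| * `|w|.
Hypothesis affine : forall e, 0 < e -> exists2 d, 0 < d &
  forall x v, `|x - x0| < d -> `|v| < d -> exists2 z,
    `|z - x - v + 2^-1 *: G v v| <= e * `|v| ^+ 2 & F z = F x + 'd F x v.

Let GvvB v : `|2^-1 *: G v v| <= C * `|v| ^+ 2.
Proof.
rewrite normrZ expr2 mulrA (le_trans _ (GB v v))//.
by rewrite ler_piMl// ger0_norm// invf_le1// ler1n.
Qed.

Let endpoint_displacement (e : R) x v z : 0 <= e ->
  `|z - x - v + 2^-1 *: G v v| <= e * `|v| ^+ 2 ->
  `|z - (x + v)| <= (C + e) * `|v| ^+ 2.
Proof.
move=> e0 H; rewrite opprD addrA -[z - x - v](addrK (2^-1 *: G v v)).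
apply: le_trans (ler_normB _ _) _.
by rewrite mulrDl addrC lerD// GvvB.
Qed.

(** The factor collects the contributions of [x], [v] and the quadratic term,
    once [d <= 1] allows [|v|^2 <= d]. *)
Let endpoint_near (e d : R) x v z : 0 <= e -> d <= 1 -> `|x - x0| < d ->
  `|v| < d -> `|z - x - v + 2^-1 *: G v v| <= e * `|v| ^+ 2 ->
  `|z - x0| < d * (3 + C + e).
Proof.
move=> e0 d1 xd vd /(endpoint_displacement e0) H.
have d0 : 0 < d by apply: le_lt_trans vd.
have v2 : `|v| ^+ 2 <= d.
  rewrite expr2 -[leRHS]mulr1 ler_pM// ?(ltW vd)//.
  by apply: le_trans (ltW vd) d1.
have -> : z - x0 = (z - (x + v)) + (x - x0) + v.
  by rewrite addrAC opprD !addrA -[_ - v + v]addrA addNr addr0 subrK.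
apply: le_lt_trans (ler_normD _ _) _.
apply: le_lt_trans (lerD (ler_normD _ _) (lexx _)) _.
have H2 : `|z - (x + v)| <= (C + e) * d.
  by apply: le_trans H _; rewrite ler_wpM2l// addr_ge0.
move: H2 xd vd d0; lra.
Qed.

(** [dF_x v] is the difference [F z - F x] of two values of a function that is
    continuous at [x0], so it is bounded for small [v], hence bounded by a
    multiple of [|v|] by homogeneity. *)
Let differential_locally_bounded : exists r L, [/\ 0 < r, r <= rho, 0 <= L &
  forall x v, `|x - x0| < r -> `|'d F x v| <= L * `|v|].
Proof.
have F0 : {for x0, continuous F}.
  by apply: differentiable_continuous; apply: FD; rewrite subrr normr0.
have /nbhs_ballP[r0 /= r00 Fb] : \forall y \near x0, `|F y - F x0| <= 1.
  by move/cvgrPdist_le : F0 => /(_ 1 ltr01); apply: filterS => y; rewrite distrC.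
have {}Fb y : `|y - x0| < r0 -> `|F y| <= `|F x0| + 1.
  move=> yr; rewrite -[F y](subrK (F x0)) (le_trans (ler_normD _ _))//.
  by rewrite addrC lerD2l; apply: Fb; rewrite -ball_normE /= distrC.
have [d d0 Hd] := affine ltr01.
pose A := 3 + C + 1.
have A0 : 0 < A by move: C0; rewrite /A; lra.
pose r := Num.min (Num.min 1 d) (Num.min rho (r0 / A)).
have r_gt0 : 0 < r by rewrite !lt_min ltr01 d0 rho0 divr_gt0.
have r1 : r <= 1 by rewrite !ge_min lexx.
have rd : r <= d by rewrite !ge_min lexx !orbT.
have rrho : r <= rho by rewrite !ge_min lexx !orbT.
have rA : r * A <= r0 by rewrite -ler_pdivlMr// !ge_min lexx !orbT.
pose M := `|F x0| + 1.
have M0 : 0 < M by rewrite ltr_wpDl.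
have small x v : `|x - x0| < r -> `|v| < r -> `|'d F x v| <= 2 * M.
  move=> xr vr.
  have [z zE Fz] := Hd x v (lt_le_trans xr rd) (lt_le_trans vr rd).
  have zr : `|z - x0| < r0.
    by apply: lt_le_trans rA; exact: endpoint_near zE.
  have xr0 : `|x - x0| < r0.
    apply: lt_le_trans xr (le_trans _ rA); rewrite ler_peMr// 1?ltW//.
    by move: C0; rewrite /A; lra.
  have -> : 'd F x v = F z - F x by rewrite Fz addrAC subrr add0r.
  by rewrite (le_trans (ler_normB _ _))// mulrDl mul1r lerD// Fb.
exists r, (4 * M / r); split => // [|x v xr].
  by rewrite divr_ge0// ?mulr_ge0// ltW.
have [->|v0] := eqVneq v 0; first by rewrite linear0 !normr0 mulr0.
have vp : 0 < `|v| by rewrite normr_gt0.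
(* [k *: v] has length [r / 2], within the range of [small]. *)
pose k := r / 2 / `|v|; have k0 : 0 < k by rewrite !divr_gt0.
have kv : `|k *: v| < r.
  by rewrite normrZ (gtr0_norm k0) /k divfK ?gt_eqF//; move: r_gt0; lra.
have := small x (k *: v) xr kv.
rewrite linearZZ /= normrM (gtr0_norm k0) => H.
rewrite -(ler_pM2l k0) (le_trans H)// /k.
have -> : r / 2 / `|v| * (4 * M / r * `|v|) = 2 * M; last exact: lexx.
by field; rewrite !gt_eqF.
Qed.

(** A bounded differential makes [F] Lipschitz, so replacing the endpoint [z] by
    [x + v] costs only [O(|v|^2)]; then [differential_increment] with [b = 0]
    applies. *)
Let differential_continuous : exists r L, [/\ 0 < r, r <= rho, 0 <= L &
  (forall x v, `|x - x0| < r -> `|'d F x v| <= L * `|v|) /\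
  (forall h w, `|h| < r -> `|'d F (x0 + h) w - 'd F x0 w| <= L * `|h| * `|w|)].
Proof.
have [r [L [r0 rrho L0 FL]]] := differential_locally_bounded.
have [d d0 Hd] := affine ltr01.
pose A := 3 + C + 1.
have A0 : 0 < A by move: C0; rewrite /A; lra.
pose s := Num.min (Num.min 1 d) (r / A).
have s_gt0 : 0 < s by rewrite !lt_min ltr01 d0 divr_gt0.
have s1 : s <= 1 by rewrite !ge_min lexx.
have sd : s <= d by rewrite !ge_min lexx !orbT.
have sA : s * A <= r by rewrite -ler_pdivlMr// !ge_min lexx !orbT.
pose K := L * (C + 1).
have K0 : 0 <= K by rewrite mulr_ge0// addr_ge0.
have expansion x v : `|x - x0| < s -> `|v| < s ->
    `|F (x + v) - F x - 'd F x v - 2^-1 * 0| <= K * `|v| ^+ 2.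
  move=> xs vs.
  have [z zE Fz] := Hd x v (lt_le_trans xs sd) (lt_le_trans vs sd).
  have zr : `|z - x0| < r.
    by apply: lt_le_trans sA; exact: endpoint_near zE.
  have xvr : `|x + v - x0| < r.
    rewrite addrAC (le_lt_trans (ler_normD _ _))//.
    apply: lt_le_trans sA; rewrite /A; have := mulr_ge0 (ltW s_gt0) C0.
    by move: xs vs s_gt0; lra.
  have [|y yr Fy] := @mean_value_segment R V F x0 z (x + v) r _ zr xvr.
    by move=> y yr; apply: FD; exact: lt_le_trans rrho.
  have -> : F (x + v) - F x - 'd F x v - 2^-1 * 0 = F (x + v) - F z.
    by rewrite Fz mulr0 subr0 opprD addrA.
  rewrite Fy; apply: le_trans (FL _ _ _) _.
    by apply: le_lt_trans yr _; rewrite gt_max zr.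
  rewrite /K -mulrA ler_wpM2l// distrC.
  exact: endpoint_displacement zE.
exists (Num.min (s / 2) r), (Num.max L (6 * K)); split.
- by rewrite lt_min r0 divr_gt0.
- by rewrite ge_min rrho orbT.
- by rewrite le_max L0.
split=> [x v xr|h w].
  apply: le_trans (FL _ _ _) _; first by apply: lt_le_trans xr _; rewrite ge_min lexx orbT.
  by rewrite ler_wpM2r// le_max lexx.
rewrite lt_min => /andP[hs _].
have := @differential_increment R V F x0 (fun x => 'd F x) (fun _ _ => 0) K s K0.
move=> /(_ _ _ _ _ _ expansion h w hs); rewrite subr0 => H.
apply: le_trans (H _ _ _ _ _) _ => //.
- by move=> *; rewrite linearD.
- by move=> *; rewrite linearZZ.
- by move=> *; rewrite addr0.
- by move=> *; rewrite mulr0.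
by rewrite !ler_wpM2r// le_max lexx orbT.
Qed.

(** Since [dF] is now known to be continuous at [x0], replacing the endpoint [z]
    by [x + v] changes [F] by [dF_x0 (G v v) / 2] up to [o(|v|^2)]; this gives the
    expansion to which [differential_increment] applies with small [K]. *)
Lemma geodesically_affine_hessian : forall e, 0 < e -> exists2 d, 0 < d &
  forall h w, `|h| < d ->
    `|'d F (x0 + h) w - 'd F x0 w - 'd F x0 (G h w)| <= e * `|h| * `|w|.
Proof.
move=> e e0.
have [r [L [r0 rrho L0 [FL Fc]]]] := differential_continuous.
(* 6 is the constant of [differential_increment]; half of [e / 6] is spent on
   the error in [z], half on the variation of the differential. *)
pose e1 := e / 6 / (2 * (L + 1)).
have L1 : 0 < L + 1 by rewrite ltr_wpDl.
have e10 : 0 < e1 by rewrite !divr_gt0// mulr_gt0.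
have [d d0 Hd] := affine e10.
pose A := 3 + C + e1.
have A0 : 0 < A by move: C0; rewrite /A; lra.
pose B := L * A * C.
have B0 : 0 <= B by rewrite !mulr_ge0// ltW.
pose s := Num.min (Num.min 1 d) (Num.min (r / A) (e / 12 / (B + 1))).
have B1 : 0 < B + 1 by rewrite ltr_wpDl.
have s_gt0 : 0 < s by rewrite !lt_min ltr01 d0 !divr_gt0.
have s1 : s <= 1 by rewrite !ge_min lexx.
have sd : s <= d by rewrite !ge_min lexx !orbT.
have sA : s * A <= r by rewrite -ler_pdivlMr// !ge_min lexx !orbT.
have sB : s * (B + 1) <= e / 12 by rewrite -ler_pdivlMr// !ge_min lexx !orbT.
have expansion x v : `|x - x0| < s -> `|v| < s ->
    `|F (x + v) - F x - 'd F x v - 2^-1 * 'd F x0 (G v v)| <= e / 6 * `|v| ^+ 2.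
  move=> xs vs.
  have [z zE Fz] := Hd x v (lt_le_trans xs sd) (lt_le_trans vs sd).
  have zs : `|z - x0| < s * A by exact: endpoint_near (ltW e10) s1 xs vs zE.
  have xvs : `|x + v - x0| < s * A.
    rewrite addrAC (le_lt_trans (ler_normD _ _))//.
    rewrite /A; have := mulr_ge0 (ltW s_gt0) C0.
    have := mulr_gt0 s_gt0 e10.
    by move: xs vs s_gt0; lra.
  have [|y yr Fy] := @mean_value_segment R V F x0 z (x + v) (s * A) _ zs xvs.
    by move=> y yr; apply: FD; apply: lt_le_trans yr (le_trans sA rrho).
  have {}yr : `|y - x0| < s * A by apply: le_lt_trans yr _; rewrite gt_max zs.
  set q := z - x - v + 2^-1 *: G v v in zE.
  have xvzE : x + v - z = 2^-1 *: G v v - q.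
    by rewrite /q [in RHS]opprD addrCA subrr addr0 !opprD !opprK addrC addrA.
  have -> : F (x + v) - F x - 'd F x v - 2^-1 * 'd F x0 (G v v) =
      ('d F (x0 + (y - x0)) (2^-1 *: G v v) - 'd F x0 (2^-1 *: G v v)) - 'd F y q.
    have -> : x0 + (y - x0) = y by rewrite addrC subrK.
    have <- : 'd F y (2^-1 *: G v v) - 'd F y q = F (x + v) - F x - 'd F x v.
      by rewrite -linearB -xvzE -Fy Fz opprD addrA.
    by rewrite (linearZZ ('d F x0)) addrAC.
  apply: le_trans (ler_normB _ _) _.
  have H1 := Fc (y - x0) (2^-1 *: G v v) (lt_le_trans yr sA).
  have H2 := FL y q (lt_le_trans yr sA).
  have v2 : 0 <= `|v| ^+ 2 by rewrite exprn_ge0.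
  have {}H1 : `|'d F (x0 + (y - x0)) (2^-1 *: G v v) - 'd F x0 (2^-1 *: G v v)| <=
      e / 12 * `|v| ^+ 2.
    apply: le_trans H1 _; apply: le_trans (_ : L * (s * A) * (C * `|v| ^+ 2) <= _).
      by rewrite ler_pM// ?mulr_ge0// ler_wpM2l// ltW.
    rewrite (mulrA _ C) ler_wpM2r// (_ : _ * C = s * B); last by rewrite /B; ring.
    by apply: le_trans sB; rewrite ler_pM2l// lerDl.
  have {}H2 : `|'d F y q| <= e / 12 * `|v| ^+ 2.
    apply: le_trans H2 _; apply: le_trans (_ : (L + 1) * (e1 * `|v| ^+ 2) <= _).
      by rewrite ler_pM// lerDl.
    rewrite mulrA ler_wpM2r// (_ : (L + 1) * e1 = e / 12)// /e1.
    by field; rewrite gt_eqF.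
  by apply: le_trans (lerD H1 H2) _; lra.
exists (s / 2); first by rewrite divr_gt0.
move=> h w hs.
have e60 : 0 <= e / 6 by rewrite divr_ge0// ltW.
have := @differential_increment R V F x0 (fun x => 'd F x)
  (fun v w => 'd F x0 (G v w)) (e / 6) s e60.
move=> /(_ _ _ _ _ _ expansion h w hs).
rewrite (_ : 6 * (e / 6) = e); last by field.
apply.
- by move=> *; rewrite linearD.
- by move=> *; rewrite linearZZ.
- by move=> *; rewrite GD linearD.
- by move=> *; rewrite GZ linearZZ.
- by move=> *; rewrite GC.
Qed.

End GeodesicallyAffine.

(** * Locality of differentials and symmetry of second derivatives *)

Section MoreDifferentials.
Variable R : realType.

Lemma near_eq_differential (V W : normedModType R) (f g : V -> W) (x : V) :
  (\forall y \near x, f y = g y) -> differentiable f x ->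
  differentiable g x /\ 'd g x = 'd f x :> (V -> W).
Proof.
move=> fg fD; apply: differential_char; first exact: diff_continuous.
move=> e e0; near=> y.
have <- : f y = g y by near: y.
have <- : f x = g x by exact: (nbhs_singleton fg).
by near: y; exact: differential_bound.
Unshelve. all: by end_near. Qed.

Lemma differential_row_sum n (W : normedModType R) (f : 'rV[R]_n -> W) x v :
  'd f x v = \sum_i (v 0 i) *: 'd f x (delta_mx 0 i : 'rV[R]_n).
Proof.
rewrite {1}(row_sum_delta v) linear_sum; apply: eq_bigr => i _.
by rewrite linearZZ.
Qed.

Lemma nondegenerate_setT : nondegenerate_interval [set: R].
Proof. by split => //; exists 0, 1; split => //; exact: ltr01. Qed.

Lemma has_deriv_unique (W : normedModType R) (u : R -> W) s (l m : W) :
  has_deriv setT u s l -> has_deriv setT u s m -> l = m.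
Proof.
move=> /(derive_on_unique nondegenerate_setT Logic.I) <-.
by move=> /(derive_on_unique nondegenerate_setT Logic.I) <-.
Qed.

(** Differentiability of [x |-> dF_x u] for each fixed [u] suffices: in
    coordinates [dF_y w] is a finite sum of products. *)
Lemma has_deriv_differential n (W : normedModType R) (f : 'rV[R]_n -> W)
    (I : set R) (y w : R -> 'rV[R]_n) s y' w' :
  has_deriv I y s y' -> has_deriv I w s w' ->
  (forall u, differentiable (fun x => 'd f x u : W) (y s)) ->
  has_deriv I (fun t => 'd f (y t) (w t) : W) s
    ('d (fun x => 'd f x (w s) : W) (y s) y' + 'd f (y s) w').
Proof.
move=> hy hw fD.
have E (J : set R) (z v : R -> 'rV[R]_n) r z' v' : has_deriv J z r z' ->
    has_deriv J v r v' -> z r = y s ->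
    has_deriv J (fun t => 'd f (z t) (v t) : W) r
     (\sum_i (v' 0 i *: 'd f (z r) (delta_mx 0 i : 'rV[R]_n) +
      v r 0 i *: 'd (fun x => 'd f x (delta_mx 0 i : 'rV[R]_n) : W) (z r) z')).
  move=> hz hv zr.
  have -> : (fun t => 'd f (z t) (v t) : W) =
      fun t => \sum_i (v t 0 i) *: 'd f (z t) (delta_mx 0 i : 'rV[R]_n).
    by apply/funext => t; exact: differential_row_sum.
  apply: has_deriv_sum => i; apply: has_derivZ; first exact: has_deriv_coord.
  by apply: (has_deriv_comp hz); rewrite zr.
have := E I y w s y' w' hy hw erefl; rewrite big_split /=.
rewrite -(differential_row_sum f) addrC.
suff <- : 'd (fun x => 'd f x (w s) : W) (y s) y' =
  \sum_i (w s 0 i *: 'd (fun x => 'd f x (delta_mx 0 i : 'rV[R]_n) : W) (y s) y').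
  by [].
(* Both sides are derivatives of the same function along the line through
   [y s] in the direction [y']. *)
pose z (t : R) := y s + t *: y'.
have z0 : z 0 = y s by rewrite /z scale0r addr0.
have hz : has_deriv setT z 0 y' by exact: has_deriv_line.
have H1 : has_deriv setT (fun t => 'd f (z t) (w s) : W) 0
    ('d (fun x => 'd f x (w s) : W) (y s) y').
  have := has_deriv_comp (f := (fun x => 'd f x (w s) : W)) hz.
  by rewrite z0 => /(_ (fD _)).
have H2 := E setT z (fun=> w s) 0 y' 0 hz (has_deriv_cst _ _ _) z0.
apply: etrans (has_deriv_unique H1 H2) _; rewrite z0; apply: eq_bigr => i _.
by rewrite mxE scale0r add0r.
Qed.

(** The mean value theorem in the direction [u] turns the second difference
    into an increment of [dg u] over [t v], and differentiability of [dg u] at the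
    base point evaluates it. *)
Lemma second_difference (V : normedModType R) (g : V -> R^o) (x u v : V) :
  (\forall y \near x, differentiable g y) ->
  differentiable (fun y => 'd g y u : R^o) x ->
  forall e, 0 < e -> \forall t \near (0 : R)^'+,
   `|g (x + t *: u + t *: v) - g (x + t *: u) - g (x + t *: v) + g x
     - t ^+ 2 * 'd (fun y => 'd g y u : R^o) x v| <= e * t ^+ 2.
Proof.
move=> gD duD e e0.
set A := 'd _ x.
have AE (s k : R) : A (s *: u + k *: v) = s * A u + k * A v.
  by rewrite (linearD A) (linearZZ A) (linearZZ A).
have ring_step (a b k s p r q : R) : a - b - r * q =
  (a - k - (s * p + r * q)) - (b - k - (s * p + 0 * q)) by ring.
pose N := `|u| + `|v| + 1.
have N0 : 0 < N by rewrite ltr_wpDl// addr_ge0.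
pose e1 := e / (2 * N).
have e10 : 0 < e1 by rewrite divr_gt0// mulr_gt0.
have /nbhs_ballP[r /= r0 rH] : \forall y \near x, differentiable g y /\
    `|'d g y u - 'd g x u - A (y - x)| <= e1 * `|y - x|.
  by apply: filterI => //; exact: (differential_bound duD).
clearbody A.
exists (r / N) => /=; first by rewrite divr_gt0.
move=> t /=; rewrite sub0r normrN => tr t0; rewrite (gtr0_norm t0) in tr.
have tN : t * N < r by rewrite -ltr_pdivlMr.
have step (s k : R) : 0 <= s <= t -> 0 <= k <= t ->
    `|s *: u + k *: v| <= t * N.
  move=> /andP[s0 st] /andP[k0 kt]; apply: le_trans (ler_normD _ _) _.
  rewrite !normrZ !ger0_norm// /N !mulrDr mulr1.
  rewrite -[leLHS]addr0 lerD ?(ltW t0)// lerD// ler_wpM2r//.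
have near_x (s k : R) : 0 <= s <= t -> 0 <= k <= t ->
    differentiable g (x + s *: u + k *: v) /\
    `|'d g (x + s *: u + k *: v) u - 'd g x u - A (s *: u + k *: v)| <=
      e1 * (t * N).
  move=> s0 k0; have := rH (x + s *: u + k *: v).
  have -> : x + s *: u + k *: v - x = s *: u + k *: v.
    by rewrite -(addrA x) addrAC subrr add0r.
  have H := step s k s0 k0.
  case.
    rewrite -ball_normE /= -(addrA x) opprD addrA subrr add0r normrN.
    exact: le_lt_trans H tN.
  move=> ? H1; split => //; apply: le_trans H1 _.
  by rewrite ler_wpM2l// ltW.
have tt : 0 <= t <= t by rewrite lexx ltW.
have t00 : 0 <= (0 : R) <= t by rewrite lexx ltW.
(* [p] compares the increment in the direction [v] with its expected value;
   the summand [0 *: v] gives both terms of [p] the same shape. *)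
pose p s := g (x + s *: u + t *: v) - g (x + s *: u + 0 *: v) - s * (t * A v).
pose p' s := 'd g (x + s *: u + t *: v) u - 'd g (x + s *: u + 0 *: v) u - t * A v.
have gl (k : R) s : 0 <= s <= t -> 0 <= k <= t ->
    has_deriv setT (fun s => g (x + s *: u + k *: v)) s
      ('d g (x + s *: u + k *: v) u).
  move=> st kt.
  have hl : has_deriv setT (fun s => x + s *: u + k *: v) s u.
    rewrite -[u in has_deriv _ _ _ u]addr0.
    apply: has_derivD; first exact: has_deriv_line.
    exact: has_deriv_cst.
  by apply: (has_deriv_comp hl); exact: (near_x s k st kt).1.
have /= := @mean_value_bound R p p' 0 t (e * t) (ltW t0).
have -> : p t - p 0 = g (x + t *: u + t *: v) - g (x + t *: u) - g (x + t *: v) + g x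
     - t ^+ 2 * A v.
  by rewrite /p !scale0r !addr0; ring.
rewrite subr0 (_ : e * t * t = e * t ^+ 2); last by ring.
apply.
  move=> s st; rewrite /p'.
  have hlin : has_deriv setT (fun s => - (s * (t * A v)) : R^o) s (- (t * A v)).
    have -> : (fun s : R => - (s * (t * A v))) = fun s => 0 + s *: (- (t * A v) : R^o).
      by apply/funext => k; rewrite add0r scalerN.
    exact: has_deriv_line.
  have hneg : has_deriv setT (fun s => - g (x + s *: u + 0 *: v)) s
      (- 'd g (x + s *: u + 0 *: v) u).
    have := has_derivM (has_deriv_cst setT s (-1 : R^o)) (gl 0 s st t00).
    rewrite mul0r add0r mulN1r.
    by apply: has_deriv_ext; [rewrite mulN1r|near=> k => _; rewrite mulN1r].
  by apply: has_derivD => //; apply: has_derivD => //; exact: gl.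
move=> s st; rewrite /p'.
have [_ H1] := near_x s t st tt.
have [_ H2] := near_x s 0 st t00.
have -> : 'd g (x + s *: u + t *: v) u - 'd g (x + s *: u + 0 *: v) u - t * A v =
  ('d g (x + s *: u + t *: v) u - 'd g x u - A (s *: u + t *: v)) -
  ('d g (x + s *: u + 0 *: v) u - 'd g x u - A (s *: u + 0 *: v)).
  by rewrite !AE; exact: ring_step.
apply: le_trans (ler_normB _ _) _; apply: le_trans (lerD H1 H2) _.
rewrite /e1 (_ : _ + _ = e * t)//.
by field; rewrite gt_eqF.
Unshelve. all: by end_near. Qed.

(** The second difference of [second_difference] is symmetric in [u] and
    [v]. *)
Lemma clairaut (V : normedModType R) (g : V -> R^o) (x u v : V) :
  (\forall y \near x, differentiable g y) ->
  differentiable (fun y => 'd g y u : R^o) x ->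
  differentiable (fun y => 'd g y v : R^o) x ->
  'd (fun y => 'd g y u : R^o) x v = 'd (fun y => 'd g y v : R^o) x u.
Proof.
move=> gD uD vD; apply/eqP; rewrite -subr_eq0 -normr_le0.
apply/ler_addgt0Pl => e e0; rewrite addr0.
have e20 : 0 < e / 2 by rewrite divr_gt0.
near (0 : R)^'+ => t.
have t0 : 0 < t by [].
have H1 : `|g (x + t *: u + t *: v) - g (x + t *: u) - g (x + t *: v) + g x
     - t ^+ 2 * 'd (fun y => 'd g y u : R^o) x v| <= e / 2 * t ^+ 2.
  by near: t; exact: second_difference.
have H2 : `|g (x + t *: v + t *: u) - g (x + t *: v) - g (x + t *: u) + g x
     - t ^+ 2 * 'd (fun y => 'd g y v : R^o) x u| <= e / 2 * t ^+ 2.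
  by near: t; exact: second_difference.
rewrite -(@ler_pM2r _ (t ^+ 2)) ?exprn_gt0//.
rewrite -{1}(gtr0_norm (exprn_gt0 2 t0)) -normrM.
set a := 'd (fun y => 'd g y u : R^o) x v in H1 *.
set b := 'd (fun y => 'd g y v : R^o) x u in H2 *.
set D := g (_ + _ + _) - _ - _ + _ in H1.
have DE : g (x + t *: v + t *: u) - g (x + t *: v) - g (x + t *: u) + g x = D.
  rewrite /D (addrAC x) addrAC -!addrA; congr (_ + _).
  by rewrite !addrA [- _ - g _]addrC.
rewrite DE in H2.
have -> : (a - b) * t ^+ 2 = (D - t ^+ 2 * b) - (D - t ^+ 2 * a) by ring.
by apply: le_trans (ler_normB _ _) _; apply: le_trans (lerD H2 H1) _; lra.
Unshelve. all: by end_near. Qed.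

End MoreDifferentials.

(** * Changes of charts *)

Section Charts.
Variables (R : realType) (n : nat) (M : riemannian_data R n).
Hypothesis riemM : riemannian_manifold M.
Implicit Types (c d : chart R M n) (p : M) (x u v w h : 'rV[R]_n).

Let SM : smooth_manifold M. Proof. by case: riemM. Qed.

Lemma chart_at_atlas p : atlas (chart_at p). Proof. by case: SM => _ _ /(_ p)[]. Qed.
Lemma chart_at_dom p : chart_dom (chart_at p) p.
Proof. by case: SM => _ _ /(_ p)[]. Qed.

Lemma chart_dom_open c : atlas c -> open (chart_dom c).
Proof. by case: SM => _ _ _ H _ /H[]. Qed.

Lemma chart_img_open c : atlas c -> open (chart_img c).
Proof. by case: SM => _ _ _ H _ /H[]. Qed.

Lemma chart_mapK c p : atlas c -> chart_dom c p ->
  chart_inv c (chart_map c p) = p.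
Proof. by case: SM => _ _ _ H _ /H[_ _ K _ _] cp; apply: K; rewrite inE. Qed.

Lemma chart_img_map c p : chart_dom c p -> chart_img c (chart_map c p).
Proof. by move=> cp; exists p. Qed.

Lemma chart_dom_inv c x : atlas c -> chart_img c x -> chart_dom c (chart_inv c x).
Proof. by move=> ac [p cp <-]; rewrite chart_mapK. Qed.

Lemma chart_invK c x : atlas c -> chart_img c x -> chart_map c (chart_inv c x) = x.
Proof. by move=> ac [p cp <-]; rewrite chart_mapK. Qed.

Lemma chart_inv_continuous c x : atlas c -> chart_img c x ->
  {for x, continuous (chart_inv c)}.
Proof. by case: SM => _ _ _ H _ /H[_ _ _ _ K] cp; apply: K; rewrite inE. Qed.

Lemma near_chart_img c p : atlas c -> chart_dom c p ->
  \forall y \near chart_map c p, chart_img c y.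
Proof.
by move=> ac cp; apply: open_nbhs_nbhs; split; [exact: chart_img_open|exists p].
Qed.

Lemma near_chart_dom c p : atlas c -> chart_dom c p ->
  \forall q \near p, chart_dom c q.
Proof. by move=> ac cp; apply: open_nbhs_nbhs; split => //; exact: chart_dom_open. Qed.

Lemma near_chart_inv_dom c d p : atlas c -> atlas d -> chart_dom c p ->
  chart_dom d p -> \forall y \near chart_map c p, chart_dom d (chart_inv c y).
Proof.
move=> ac ad cp dp.
have := chart_inv_continuous ac (chart_img_map cp).
by apply; rewrite chart_mapK//; exact: near_chart_dom.
Qed.

Definition overlap c d : set 'rV[R]_n :=
  chart_map c @` (chart_dom c `&` chart_dom d).

Lemma near_overlap c d p : atlas c -> atlas d -> chart_dom c p ->
  chart_dom d p -> \forall y \near chart_map c p, overlap c d y.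
Proof.
move=> ac ad cp dp; near=> y.
have cy : chart_img c y by near: y; exact: near_chart_img.
have dy : chart_dom d (chart_inv c y) by near: y; exact: near_chart_inv_dom.
by exists (chart_inv c y); [split => //; exact: chart_dom_inv|exact: chart_invK].
Unshelve. all: by end_near. Qed.

Definition transition c d : 'rV[R]_n -> 'rV[R]_n := chart_map d \o chart_inv c.

Lemma transition_smooth c d : atlas c -> atlas d ->
  smooth (overlap c d) (transition c d).
Proof. by case: SM => _ _ _ _ H ac ad; exact: H. Qed.

Lemma transitionE c d p : atlas c -> chart_dom c p ->
  transition c d (chart_map c p) = chart_map d p.
Proof. by move=> ac cp; rewrite /transition /= chart_mapK. Qed.

Lemma transition_differentiable c d p : atlas c -> atlas d -> chart_dom c p ->
  chart_dom d p -> differentiable (transition c d) (chart_map c p).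
Proof.
move=> ac ad cp dp; apply: (transition_smooth ac ad [::]).
by exists p.
Qed.

(** The chain rule for [phi o d^-1 o (d o c^-1)], which agrees with
    [phi o c^-1] near the point only; both functions of the manifold and chart
    maps are instances of [phi]. *)
Lemma change_chart (W : normedModType R) (phi : M -> W) c d p :
  atlas c -> atlas d -> chart_dom c p -> chart_dom d p ->
  differentiable (phi \o chart_inv d) (chart_map d p) ->
  differentiable (phi \o chart_inv c) (chart_map c p) /\
  forall v, 'd (phi \o chart_inv c) (chart_map c p) v =
    'd (phi \o chart_inv d) (chart_map d p) ('d (transition c d) (chart_map c p) v).
Proof.
move=> ac ad cp dp fD.
have tD := transition_differentiable ac ad cp dp.
have fD' : differentiable (phi \o chart_inv d) (transition c d (chart_map c p)).
  by rewrite transitionE.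
have near_eq : \forall y \near chart_map c p,
    ((phi \o chart_inv d) \o transition c d) y = (phi \o chart_inv c) y.
  near=> y.
  have dy : chart_dom d (chart_inv c y) by near: y; exact: near_chart_inv_dom.
  by rewrite /= chart_mapK.
have [D E] := near_eq_differential near_eq (differentiable_comp tD fD').
split=> [|v]; first exact: D.
have E2 := congr1 (fun L : 'rV[R]_n -> W => L v) (diff_comp tD fD').
rewrite -(transitionE d ac cp).
exact: etrans (congr1 (fun L : 'rV[R]_n -> W => L v) E) E2.
Unshelve. all: by end_near. Qed.

Lemma transition_comp c d e p v : atlas c -> atlas d -> atlas e ->
  chart_dom c p -> chart_dom d p -> chart_dom e p ->
  'd (transition c e) (chart_map c p) v =
  'd (transition d e) (chart_map d p) ('d (transition c d) (chart_map c p) v).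
Proof.
move=> ac ad ae cp dp ep.
have [_] := @change_chart _ (chart_map e) c d p ac ad cp dp
  (transition_differentiable ad ae dp ep).
exact.
Qed.

Lemma transition_id c p v : atlas c -> chart_dom c p ->
  'd (transition c c) (chart_map c p) v = v.
Proof.
move=> ac cp.
have near_eq : \forall y \near chart_map c p, id y = transition c c y.
  near=> y; have cy : chart_img c y by near: y; exact: near_chart_img.
  by rewrite /transition /= chart_invK.
have D : differentiable (@id 'rV[R]_n) (chart_map c p) by exact: ex_diff.
have E : 'd (@id 'rV[R]_n) (chart_map c p) = id :> ('rV[R]_n -> 'rV[R]_n).
  exact: diff_val.
by have [_ ->] := near_eq_differential near_eq D; rewrite E.
Unshelve. all: by end_near. Qed.

(** Differentials of transitions are invertible; this is used both to solve
    [J w = e] and to cancel [J]. *)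
Lemma transitionK c d p v : atlas c -> atlas d -> chart_dom c p ->
  chart_dom d p ->
  'd (transition d c) (chart_map d p) ('d (transition c d) (chart_map c p) v) = v.
Proof.
by move=> ac ad cp dp; rewrite -transition_comp// transition_id.
Qed.

Lemma transition_differential_differentiable c d p u : atlas c -> atlas d ->
  chart_dom c p -> chart_dom d p ->
  differentiable (fun y => 'd (transition c d) y u) (chart_map c p).
Proof.
move=> ac ad cp dp.
have pd i : differentiable (fun y =>
    'd (transition c d) y (delta_mx 0 i : 'rV[R]_n)) (chart_map c p).
  have := transition_smooth ac ad [:: i].
  move=> /(_ (chart_map c p)) H.
  have {}H : differentiable (partial i (transition c d)) (chart_map c p).
    by apply: H; exists p.
  apply: (near_eq_differential _ H).1.
  near=> y.
  have [q [cq dq] <-] : overlap c d y by near: y; exact: near_overlap.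
  by rewrite /partial deriveE//; exact: transition_differentiable.
have -> : (fun y => 'd (transition c d) y u) =
    \sum_i (fun y => u 0 i *: 'd (transition c d) y (delta_mx 0 i : 'rV[R]_n)).
  apply/funext => y.
  apply: (etrans (differential_row_sum (transition c d) y u)).
  by rewrite fct_sumE.
by apply: differentiable_sum => i; apply: differentiableZ.
Unshelve. all: by end_near. Qed.

Definition transition_hessian c d x u v : 'rV[R]_n :=
  'd (fun y => 'd (transition c d) y u) x v.

Lemma differential_coord_rV (f : 'rV[R]_n -> 'rV[R]_n) x u k :
  differentiable f x ->
  differentiable (fun y => f y 0 k : R^o) x /\
  'd (fun y => f y 0 k : R^o) x u = 'd f x u 0 k.
Proof.
move=> fD; have H z : has_deriv setT (fun t => z + t *: u) 0 u.
  exact: has_deriv_line.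
have D : differentiable (fun y => f y 0 k : R^o) x.
  exact: (differentiable_comp fD (differentiable_coord _ _ _)).
split => //.
have x0 : x + 0 *: u = x by rewrite scale0r addr0.
have := has_deriv_comp (f := fun y => f y 0 k : R^o) (H x).
rewrite x0 => /(_ D) H1.
have := has_deriv_comp (f := f) (H x).
rewrite x0 => /(_ fD) /(has_deriv_coord (j := k)) H2.
exact: has_deriv_unique H1 H2.
Qed.

Lemma transition_hessian_sym c d p u v : atlas c -> atlas d -> chart_dom c p ->
  chart_dom d p ->
  transition_hessian c d (chart_map c p) u v =
  transition_hessian c d (chart_map c p) v u.
Proof.
move=> ac ad cp dp; apply/rowP => k; rewrite /transition_hessian.
set x := chart_map c p; set f := transition c d.
have fD y : overlap c d y -> differentiable f y.
  by move=> [q [cq dq] <-]; exact: transition_differentiable.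
pose g y := f y 0 k : R^o.
have gD : \forall y \near x, differentiable g y.
  near=> y; have /fD : overlap c d y by near: y; exact: near_overlap.
  by move=> /(differential_coord_rV 0 k)[].
have near_eq w : \forall y \near x, 'd f y w 0 k = 'd g y w.
  near=> y; have /fD : overlap c d y by near: y; exact: near_overlap.
  by move=> /(differential_coord_rV w k)[].
have ddf w := transition_differential_differentiable w ac ad cp dp.
have dg w z : differentiable (fun y => 'd g y w : R^o) x /\
    'd (fun y => 'd g y w : R^o) x z = 'd (fun y => 'd f y w) x z 0 k.
  have [D1 E1] := differential_coord_rV z k (ddf w).
  have [D2 E2] := near_eq_differential (near_eq w) D1.
  by split; [exact: D2|rewrite E2].
rewrite -!(dg _ _).2.
by apply: clairaut => //; [exact: (dg u 0).1|exact: (dg v 0).1].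
Unshelve. all: by end_near. Qed.

End Charts.

(** * The Gram matrix and its derivative *)

Section Gram.
Variables (R : realType) (n : nat) (M : riemannian_data R n).
Hypothesis riemM : riemannian_manifold M.
Implicit Types (c d : chart R M n) (p : M) (x u v w h : 'rV[R]_n).

Let ca p := chart_at_atlas riemM p.
Let cd p := chart_at_dom riemM p.

Definition gram_form c x u v : R := (u *m gram c x *m v^T) 0 0.

Let vec c p u : 'rV[R]_n := 'd (transition c (chart_at p)) (chart_map c p) u.

(** The Gram matrix of [c] is that of the preferred chart of the point,
    pulled back by the differential of the transition. *)
Lemma gram_lin1 c p : atlas c -> chart_dom c p ->
  gram c (chart_map c p) =
  lin1_mx (vec c p) *m metric p *m (lin1_mx (vec c p))^T.
Proof.
move=> ac cp; apply/matrixP => i j.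
set J := lin1_mx _.
have rowJ k : row k J = vec c p (delta_mx 0 k).
  by apply/rowP => l; rewrite !mxE.
have -> : (J *m metric p *m J^T) i j = (row i J *m metric p *m (row j J)^T) 0 0.
  rewrite [LHS]mxE [RHS]mxE; apply: eq_bigr => l _; rewrite -row_mul.
  by congr (_ * _); rewrite [in RHS]mxE// [in LHS]mxE [RHS]mxE.
rewrite !rowJ /gram mxE /inner /coord_vector /vec /transition.
by rewrite (chart_mapK riemM ac cp).
Qed.

Lemma gram_form_inner c p u v : atlas c -> chart_dom c p ->
  gram_form c (chart_map c p) u v = inner (vec c p u : tangent p) (vec c p v).
Proof.
move=> ac cp; rewrite /gram_form gram_lin1// /inner.
by rewrite !mulmxA mul_rV_lin1 -mulmxA -trmx_mul mul_rV_lin1.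
Qed.

Lemma gram_form_transition c d p u v : atlas c -> atlas d -> chart_dom c p ->
  chart_dom d p ->
  gram_form c (chart_map c p) u v =
  gram_form d (chart_map d p) ('d (transition c d) (chart_map c p) u)
    ('d (transition c d) (chart_map c p) v).
Proof.
move=> ac ad cp dp.
have E w : vec c p w = vec d p ('d (transition c d) (chart_map c p) w).
  exact: (transition_comp riemM w ac ad (ca p) cp dp (cd p)).
rewrite (gram_form_inner _ _ ac cp) (gram_form_inner _ _ ad dp) (E u) (E v).
by [].
Qed.

Lemma gram_form_gt0 c p u : atlas c -> chart_dom c p -> u != 0 ->
  0 < gram_form c (chart_map c p) u u.
Proof.
move=> ac cp u0; rewrite gram_form_inner//.
have [_ _ pos _] := riemM; apply: pos; apply: contra u0 => /eqP vu0.
apply/eqP; apply: etrans (esym (transitionK riemM u ac (ca p) cp (cd p))) _.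
apply: etrans (congr1
  ('d (transition (chart_at p) c) (chart_map (chart_at p) p)) vu0) _.
exact: linear0.
Qed.

Lemma gram_form_sym c p u v : atlas c -> chart_dom c p ->
  gram_form c (chart_map c p) u v = gram_form c (chart_map c p) v u.
Proof. by move=> ac cp; rewrite !gram_form_inner//; case: riemM. Qed.

Lemma gram_form_delta c x i j :
  gram_form c x (delta_mx 0 i) (delta_mx 0 j) = gram c x i j.
Proof. by rewrite /gram_form -rowE trmx_delta -colE !mxE. Qed.

Lemma gram_sym c p i j : atlas c -> chart_dom c p ->
  gram c (chart_map c p) i j = gram c (chart_map c p) j i.
Proof. by move=> ac cp; rewrite -!gram_form_delta gram_form_sym. Qed.

Lemma gram_unit c p : atlas c -> chart_dom c p ->
  gram c (chart_map c p) \in unitmx.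
Proof.
move=> ac cp; rewrite -row_free_unit -kermx_eq0; apply: contraT.
move=> /rowV0Pn[u /sub_kermxP ug u0].
by have := gram_form_gt0 ac cp u0; rewrite /gram_form ug mul0mx mxE ltxx.
Qed.

Lemma gram_smooth c i j : atlas c ->
  smooth (chart_img c) (fun x => gram c x i j : R^o).
Proof. by move=> ac; case: riemM => _ _ _ /(_ c ac). Qed.

Lemma gram_differentiable c i j p : atlas c -> chart_dom c p ->
  differentiable (fun x => gram c x i j : R^o) (chart_map c p).
Proof. by move=> ac cp; apply: (gram_smooth i j ac [::]); exists p. Qed.

Definition dgram c x h : 'M[R]_n :=
  \matrix_(i, j) 'd (fun y => gram c y i j : R^o) x h.

Definition dgram_form c x h u v : R := (u *m dgram c x h *m v^T) 0 0.

(** Differentiate [g_c (u, v) = g_d (J u, J v)] in the direction [h]: the two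
    terms with [transition_hessian] come from the dependence of [J] on the
    point. *)
Lemma dgram_form_transition c d p h u v : atlas c -> atlas d -> chart_dom c p ->
  chart_dom d p ->
  let x := chart_map c p in let y := chart_map d p in
  let J := 'd (transition c d) x in
  dgram_form c x h u v =
    gram_form d y (transition_hessian c d x u h) (J v) + dgram_form d y (J h) (J u) (J v) +
    gram_form d y (J u) (transition_hessian c d x v h).
Proof.
move=> ac ad cp dp x y J.
pose z (t : R) := x + t *: h.
have z0 : z 0 = x by rewrite /z scale0r addr0.
have hz : has_deriv setT z 0 h by exact: has_deriv_line.
have H1 : has_deriv setT (fun t => gram_form c (z t) u v : R^o) 0
    (dgram_form c x h u v).
  have hG i j : has_deriv setT (fun t => gram c (z t) i j : R^o) 0
      (dgram c x h i j).
    have := has_deriv_comp (f := fun y => gram c y i j : R^o) hz.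
    by rewrite z0 => /(_ (gram_differentiable i j ac cp)); rewrite mxE.
  exact: derivative_form_cst hG.
have tD : differentiable (transition c d) x by exact: transition_differentiable.
have hA w : has_deriv setT (fun t => 'd (transition c d) (z t) w) 0
    (transition_hessian c d x w h).
  have := has_deriv_comp (f := fun y => 'd (transition c d) y w) hz.
  rewrite z0 => H; apply: H.
  exact: transition_differential_differentiable.
have tx : transition c d x = y by exact: transitionE.
have H2 : has_deriv setT (fun t => gram_form d (transition c d (z t))
    ('d (transition c d) (z t) u) ('d (transition c d) (z t) v) : R^o) 0
    (gram_form d y (transition_hessian c d x u h) (J v) +
     dgram_form d y (J h) (J u) (J v) +
    gram_form d y (J u) (transition_hessian c d x v h)).
  have ht : has_deriv setT (transition c d \o z) 0 (J h).
    by have := has_deriv_comp (f := transition c d) hz; rewrite z0; apply.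
  have hG i j : has_deriv setT (fun t => gram d (transition c d (z t)) i j : R^o) 0
      (dgram d y (J h) i j).
    have := has_deriv_comp (f := fun y => gram d y i j : R^o) ht.
    rewrite /= z0 tx => H.
    by have := H (gram_differentiable i j ad dp); rewrite mxE.
  by have := derivative_form (hA u) (hA v) hG; rewrite z0 tx.
apply: has_deriv_unique H1 _; apply: has_deriv_ext H2.
  by rewrite z0 tx (gram_form_transition _ _ ac ad cp dp).
have : \forall t \near (0 : R), overlap c d (z t).
  have zc : {for 0, continuous z}.
    apply: differentiable_continuous; apply/derivable1_diffP.
    by have [] := has_deriv_setT_is_derive hz.
  apply: zc; rewrite z0; exact: near_overlap.
apply: filterS => t [q [cq dq] zt] _.
by rewrite -zt (gram_form_transition _ _ ac ad cq dq) (transitionE riemM d ac cq).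
Qed.

End Gram.

(** * Christoffel symbols in overlapping charts *)

Section Christoffel.
Variables (R : realType) (n : nat) (M : riemannian_data R n).
Hypothesis riemM : riemannian_manifold M.
Implicit Types (c d : chart R M n) (p : M) (x u v w h : 'rV[R]_n).

(** The Christoffel symbols at [x] as a vector-valued bilinear map; its value
    on [u], [v] is the correction term of the covariant derivative. *)
Definition christoffel_map c x u v : 'rV[R]_n :=
  \row_k \sum_i \sum_j christoffel c x i j k * u 0 i * v 0 j.

(** Arbitrary coefficients are allowed so that bounds apply to the difference of
    the Christoffel symbols at two points. *)
Definition tensor (T : 'I_n -> 'I_n -> 'I_n -> R) u v : 'rV[R]_n :=
  \row_k \sum_i \sum_j T i j k * u 0 i * v 0 j.

Lemma tensorB T S u v :
  tensor (fun i j k => T i j k - S i j k) u v = tensor T u v - tensor S u v.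
Proof.
apply/rowP => k; rewrite !mxE -sumrB; apply: eq_bigr => i _.
by rewrite -sumrB; apply: eq_bigr => j _; rewrite -!mulrA -mulrBl.
Qed.

Lemma christoffel_mapDl c x u v w :
  christoffel_map c x (u + v) w = christoffel_map c x u w + christoffel_map c x v w.
Proof.
apply/rowP => k; rewrite !mxE -big_split; apply: eq_bigr => i _.
by rewrite -big_split; apply: eq_bigr => j _; rewrite mxE /=; ring.
Qed.

Lemma christoffel_mapZl c x r v w :
  christoffel_map c x (r *: v) w = r *: christoffel_map c x v w.
Proof.
apply/rowP => k; rewrite !mxE big_distrr; apply: eq_bigr => i _.
by rewrite big_distrr; apply: eq_bigr => j _; rewrite mxE /=; ring.
Qed.

Lemma tensor_bound (T : 'I_n -> 'I_n -> 'I_n -> R) (K : R) u v : 0 <= K ->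
  (forall i j k, `|T i j k| <= K) ->
  `|tensor T u v| <= n%:R ^+ 2 * K * `|u| * `|v|.
Proof.
move=> K0 HK.
have nb (z : 'rV[R]_n) i : `|z 0 i| <= `|z| by move: i; apply/ler_rV_norm.
apply/ler_rV_norm => [|k]; first by rewrite !mulr_ge0.
rewrite mxE; apply: le_trans (ler_norm_sum _ _ _) _.
have -> : n%:R ^+ 2 * K * `|u| * `|v| =
    \sum_(i < n) \sum_(j < n) (K * `|u| * `|v|).
  rewrite !sumr_const card_ord -[in RHS](mulr_natl (K * _ * _)) -[RHS]mulr_natl.
  by ring.
apply: ler_sum => i _; apply: le_trans (ler_norm_sum _ _ _) _.
apply: ler_sum => j _; rewrite normrM [X in X * _]normrM.
by apply: ler_pM; rewrite ?mulr_ge0 ?nb//; apply: ler_pM; rewrite ?nb ?HK.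
Qed.

Lemma partial_gram c p (l i j : 'I_n) : atlas c -> chart_dom c p ->
  @partial R n R^o l (fun y => gram c y i j) (chart_map c p) =
  dgram c (chart_map c p) (delta_mx 0 l) i j.
Proof.
move=> ac cp; rewrite mxE /partial deriveE; first by [].
exact: gram_differentiable.
Qed.

Lemma christoffel_map_sym c p u v : atlas c -> chart_dom c p ->
  christoffel_map c (chart_map c p) u v = christoffel_map c (chart_map c p) v u.
Proof.
move=> ac cp; apply/rowP => k; rewrite !mxE exchange_big.
apply: eq_bigr => i _; apply: eq_bigr => j _.
rewrite mulrAC; congr (_ * _ * _).
rewrite /christoffel; congr (_ * _); apply: eq_bigr => l _; congr (_ * _).
rewrite [X in X - _]addrC; congr (_ - _).
rewrite /partial; apply: near_eq_derive.
have : \forall y \near chart_map c p, chart_img c y by exact: near_chart_img.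
by apply: filterS => y [q cq <-]; exact: gram_sym.
Qed.

Lemma dgram_formE c x h u v : dgram_form c x h u v =
  \sum_l \sum_i \sum_j dgram c x (delta_mx 0 l) i j * h 0 l * u 0 i * v 0 j.
Proof.
rewrite /dgram_form mxE exchange_big /=.
under [RHS]eq_bigr => i _ do rewrite exchange_big /=.
rewrite exchange_big /=; apply: eq_bigr => j _.
rewrite mxE big_distrl; apply: eq_bigr => i _ /=.
rewrite [dgram c x h i j]mxE [v^T _ _]mxE.
rewrite [X in u 0 i * X](differential_row_sum (fun y => gram c y i j : R^o) x h).
rewrite big_distrr big_distrl; apply: eq_bigr => l _ /=.
rewrite [dgram c x _ i j]mxE.
rewrite (_ : forall a b : R, a *: (b : R^o) = a * b)//.
move: ('d _ x _) => a; ring.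
Qed.

(** The Koszul formula on the diagonal.  Contracting with the Gram matrix
    removes its inverse from the definition of the Christoffel symbols. *)
Lemma christoffel_map_koszul c p u w : atlas c -> chart_dom c p ->
  let x := chart_map c p in
  gram_form c x (christoffel_map c x u u) w =
  dgram_form c x u u w - 2^-1 * dgram_form c x w u u.
Proof.
move=> ac cp x.
pose D (h i j : 'I_n) := dgram c x (delta_mx 0 h) i j.
pose b : 'rV[R]_n := \row_l \sum_i \sum_j
  2^-1 * (D i j l + D j i l - D l i j) * u 0 i * u 0 j.
have E : christoffel_map c x u u = b *m (invmx (gram c x))^T.
  apply/rowP => k; rewrite !mxE.
  under [RHS]eq_bigr => l _.
    rewrite [b 0 l]mxE big_distrl /=.
    under eq_bigr => i _ do rewrite big_distrl /=.
    over.
  rewrite [RHS]exchange_big /=; apply: eq_bigr => i _.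
  rewrite [RHS]exchange_big /=; apply: eq_bigr => j _.
  rewrite /christoffel big_distrr !big_distrl; apply: eq_bigr => l _ /=.
  by rewrite !partial_gram// [_^T _ _]mxE /D /x; ring.
have gT : (gram c x)^T = gram c x.
  by apply/matrixP => i j; rewrite mxE; exact: gram_sym.
have -> : gram_form c x (christoffel_map c x u u) w = (b *m w^T) 0 0.
  rewrite /gram_form E trmx_inv gT -(mulmxA b) mulVmx ?mulmx1//.
  exact: gram_unit.
rewrite !dgram_formE mxE.
have -> : \sum_l \sum_i \sum_j dgram c x (delta_mx 0 l) i j * u 0 l * u 0 i * w 0 j =
   \sum_l \sum_i \sum_j D i j l * u 0 i * u 0 j * w 0 l.
  rewrite [RHS]exchange_big /=; apply: eq_bigr => l _.
  by rewrite [RHS]exchange_big /=; apply: eq_bigr => i _; apply: eq_bigr.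
have E2 : \sum_l \sum_i \sum_j D i j l * u 0 i * u 0 j * w 0 l =
   \sum_l \sum_i \sum_j D j i l * u 0 i * u 0 j * w 0 l.
  apply: eq_bigr => l _; rewrite exchange_big; apply: eq_bigr => i _.
  by apply: eq_bigr => j _; ring.
set S := \sum_l _ in E2 *; have -> : S = 2^-1 * S + 2^-1 * S by field.
rewrite {2}E2 /S !big_distrr -big_split -sumrB /=; apply: eq_bigr => l _.
rewrite [w^T _ _]mxE [b 0 l]mxE big_distrl !big_distrr -big_split -sumrB /=.
apply: eq_bigr => i _; rewrite big_distrl !big_distrr -big_split -sumrB /=.
apply: eq_bigr => j _; rewrite -/(D l i j).
by move: (D i j l) (D j i l) (D l i j) => *; ring.
Qed.

End Christoffel.

Section Geodesics.
Variables (R : realType) (n : nat) (M : riemannian_data R n).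
Hypothesis riemM : riemannian_manifold M.
Implicit Types (c d : chart R M n) (p : M) (x u v w : 'rV[R]_n).

Lemma gram_formDl c x u v w :
  gram_form c x (u + v) w = gram_form c x u w + gram_form c x v w.
Proof. by rewrite /gram_form !mulmxDl mxE. Qed.

Lemma gram_formBl c x u v w :
  gram_form c x (u - v) w = gram_form c x u w - gram_form c x v w.
Proof. by rewrite /gram_form !mulmxBl !mxE. Qed.

(** Pair both sides with [J w] in the metric of [d].  By the Koszul formulas in
    [c] and [d] and [dgram_form_transition], the difference consists of terms in
    the Hessian of the transition, which cancel by its symmetry; the vectors
    [J w] fill the space and the metric is definite. *)
Lemma christoffel_map_transition c d p u : atlas c -> atlas d -> chart_dom c p ->
  chart_dom d p ->
  let x := chart_map c p in let y := chart_map d p in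
  let J := 'd (transition c d) x in
  J (christoffel_map c x u u) =
  christoffel_map d y (J u) (J u) + transition_hessian c d x u u.
Proof.
move=> ac ad cp dp x y J.
have alg (A B D E : R) :
  A + D + B - 2^-1 * (B + E + B) = D - 2^-1 * E + A by field.
have H w : gram_form d y (J (christoffel_map c x u u)) (J w) =
    gram_form d y (christoffel_map d y (J u) (J u) + transition_hessian c d x u u)
      (J w).
  apply: etrans (esym (gram_form_transition riemM _ _ ac ad cp dp)) _.
  rewrite (christoffel_map_koszul riemM u w ac cp) gram_formDl.
  rewrite (christoffel_map_koszul riemM (J u) (J w) ad dp).
  rewrite (dgram_form_transition riemM u u w ac ad cp dp).
  rewrite (dgram_form_transition riemM w u u ac ad cp dp).
  rewrite -/x -/y -/J (transition_hessian_sym riemM w u ac ad cp dp) -/x.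
  rewrite (gram_form_sym riemM (transition_hessian c d x u w) (J u) ad dp) -/y.
  exact: alg.
set a := J _ in H *; set b := _ + _ in H *.
apply/eqP; rewrite -subr_eq0; apply/negPn/negP => ab0.
have := gram_form_gt0 riemM ad dp ab0.
have wE := transitionK riemM (a - b) ad ac dp cp.
rewrite -{2}wE gram_formBl -/x -/J H subrr ltxx; by [].
Qed.

(** * The geodesic equation in an arbitrary chart *)

Section Curve.
Variables (I : set R) (a : R -> M).
Hypothesis nI : nondegenerate_interval I.
Hypothesis sa : smooth_curve I a.

Lemma curve_near_chart c s : atlas c -> I s -> chart_dom c (a s) ->
  \forall t \near s, I t -> chart_dom c (a t).
Proof.
move=> ac Is cs.
have [ca _] := sa.
have := ca s (chart_dom c) (near_chart_dom riemM ac cs).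
have E : nbhs (s : subspace I) = within I (nbhs s) by rewrite (nbhs_subspace_in Is).
by rewrite /fmap /= nbhs_filterE /= E.
Qed.

Lemma curve_chart_deriv c s : atlas c -> I s -> chart_dom c (a s) ->
  has_deriv I (chart_map c \o a) s (derive_on I (chart_map c \o a) s).
Proof. by move=> ac Is cs; have [_ H] := sa; exact: (H c ac 0%N s Is cs). Qed.

Lemma curve_chart_deriv2 c s : atlas c -> I s -> chart_dom c (a s) ->
  has_deriv I (derive_on I (chart_map c \o a)) s
    (derive_on I (derive_on I (chart_map c \o a)) s).
Proof. by move=> ac Is cs; have [_ H] := sa; exact: (H c ac 1%N s Is cs). Qed.

Lemma derive_on_transition c d s : atlas c -> atlas d -> I s ->
  chart_dom c (a s) -> chart_dom d (a s) ->
  derive_on I (chart_map d \o a) s =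
  'd (transition c d) (chart_map c (a s)) (derive_on I (chart_map c \o a) s).
Proof.
move=> ac ad Is cs ds; apply: derive_on_unique => //.
have tD := transition_differentiable riemM ac ad cs ds.
have H := has_deriv_comp (f := transition c d) (curve_chart_deriv ac Is cs) tD.
apply: has_deriv_ext H; first exact: transitionE.
have := curve_near_chart ac Is cs; apply: filterS => t H It.
by apply: (transitionE riemM d ac); exact: H.
Qed.

Lemma components_velocity c s : atlas c -> I s -> chart_dom c (a s) ->
  components c (velocity I a s) = derive_on I (chart_map c \o a) s.
Proof.
move=> ac Is cs; apply/esym.
exact: (derive_on_transition
  (chart_at_atlas riemM (a s)) ac Is (chart_at_dom riemM (a s)) cs).
Qed.

(** The equation holds by definition in the preferred chart [d] of the current
    point.  There the acceleration is [J z''] plus the second derivative of the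
    transition at [z'], and the latter is the defect in the transformation law
    of the Christoffel symbols. *)
Lemma geodesic_equation c s : atlas c -> I s -> chart_dom c (a s) ->
  cov_derive I (velocity I a) s = 0 :> 'rV[R]_n ->
  let z := chart_map c \o a in let z' := derive_on I z in
  has_deriv I z' s (- christoffel_map c (z s) (z' s) (z' s)).
Proof.
move=> ac Is cs geo z z'.
set d := chart_at (a s).
have ad : atlas d := chart_at_atlas riemM (a s).
have ds : chart_dom d (a s) := chart_at_dom riemM (a s).
pose y := chart_map d \o a; pose y' := derive_on I y.
pose z'' := derive_on I z' s.
have hz : has_deriv I z s (z' s) by exact: curve_chart_deriv.
have hz' : has_deriv I z' s z'' by exact: curve_chart_deriv2.
pose J := 'd (transition c d) (z s).
have y'E t : I t -> chart_dom c (a t) -> chart_dom d (a t) ->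
    y' t = 'd (transition c d) (z t) (z' t).
  by move=> It ct dt; exact: derive_on_transition.
have hy' : has_deriv I y' s (transition_hessian c d (z s) (z' s) (z' s) + J z'').
  have D u : differentiable (fun x => 'd (transition c d) x u) (z s).
    exact: (transition_differential_differentiable riemM u ac ad cs ds).
  have H := has_deriv_differential hz hz' D.
  apply: has_deriv_ext H; first by apply/esym; exact: y'E.
  apply: filterS2 (curve_near_chart ac Is cs) (curve_near_chart ad Is ds).
  move=> t ct dt It; apply/esym.
  exact: (y'E t It (ct It) (dt It)).
have compE t : I t -> chart_dom d (a t) -> components d (velocity I a t) = y' t.
  by move=> It dt; exact: components_velocity.
have dcE : derive_on I (fun t => components d (velocity I a t)) s =
    transition_hessian c d (z s) (z' s) (z' s) + J z''.
  apply: (derive_on_unique nI Is); apply: has_deriv_ext hy'.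
    by apply/esym; exact: (compE s Is ds).
  apply: filterS (curve_near_chart ad Is ds) => t dt It; apply/esym.
  exact: (compE t It (dt It)).
have E : transition_hessian c d (z s) (z' s) (z' s) + J z'' +
    christoffel_map d (chart_map d (a s)) (y' s) (y' s) = 0.
  apply: etrans geo; rewrite /cov_derive -/d dcE; congr (_ + _).
  apply/rowP => k; rewrite !mxE; apply: eq_bigr => i _; apply: eq_bigr => j _.
  by rewrite (compE s Is ds).
have JE := christoffel_map_transition (z' s) ac ad cs ds.
have yJ : y' s = J (z' s) by exact: y'E.
have alg (A B C : 'rV[R]_n) : A + (B + C) = C + A + B.
  by rewrite [RHS]addrAC [C + B]addrC addrC.
have J0 : J z'' = J (- christoffel_map c (z s) (z' s) (z' s)).
  apply/eqP; rewrite (linearN J) -addr_eq0.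
  apply/eqP; apply: etrans E; rewrite yJ.
  apply: etrans (congr1 (fun q => J z'' + q) JE) _.
  exact: alg.
suff -> : - christoffel_map c (z s) (z' s) (z' s) = z'' by [].
apply: etrans (esym (transitionK riemM _ ac ad cs ds)) _.
apply: etrans (transitionK riemM z'' ac ad cs ds).
by congr ('d _ _ _); apply/esym; exact: J0.
Qed.

End Curve.
End Geodesics.

(** * Continuity of the Christoffel symbols *)

Section MatrixLimits.
Variables (R : realType) (T : Type) (F : set_system T).
Context {FF : Filter F}.

Lemma cvg_det n (A : T -> 'M[R]_n) (B : 'M[R]_n) :
  (forall i j, A t i j @[t --> F] --> B i j) -> \det (A t) @[t --> F] --> \det B.
Proof.
move=> AB; rewrite /determinant.
apply: (@cvg_big R _ +%R 0); [exact: add_continuous|move=> s _].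
apply: cvgM; first exact: cvg_cst.
by apply: (@cvg_big R _ *%R 1) => //; exact: mul_continuous.
Qed.

(** Cramer's rule: entries of the inverse are quotients of determinants. *)
Lemma cvg_invmx n (A : T -> 'M[R]_n) (B : 'M[R]_n) :
  (forall i j, A t i j @[t --> F] --> B i j) -> B \in unitmx ->
  (\forall t \near F, A t \in unitmx) ->
  forall i j, invmx (A t) i j @[t --> F] --> invmx B i j.
Proof.
move=> AB Bu Au i j.
have E (C : 'M[R]_n) : C \in unitmx ->
    invmx C i j = (\det C)^-1 * ((-1) ^+ (j + i) * \det (row' j (col' i C))).
  by move=> Cu; rewrite /invmx Cu !mxE.
rewrite (E _ Bu).
apply: (cvg_trans (G := (\det (A t))^-1 *
  ((-1) ^+ (j + i) * \det (row' j (col' i (A t)))) @[t --> F])).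
  by apply: near_eq_cvg; apply: filterS Au => t /E ->.
apply: cvgM.
  apply: cvgV; last exact: cvg_det.
  by have := Bu; rewrite unitmxE unitfE.
apply: cvgM; first exact: cvg_cst.
apply: cvg_det => k l; rewrite !mxE.
have -> : (fun t => row' j (col' i (A t)) k l) = fun t => A t (lift j k) (lift i l).
  by apply/funext => t; rewrite !mxE.
exact: AB.
Qed.

End MatrixLimits.

Section ChristoffelContinuity.
Variables (R : realType) (n : nat) (M : riemannian_data R n).
Hypothesis riemM : riemannian_manifold M.
Implicit Types (c d : chart R M n) (p : M) (x u v w : 'rV[R]_n).

Lemma partial_gram_continuous c p (l i j : 'I_n) : atlas c -> chart_dom c p ->
  {for chart_map c p, continuous (@partial R n R^o l (fun y => gram c y i j))}.
Proof.
move=> ac cp; apply: differentiable_continuous.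
by apply: (gram_smooth riemM i j ac [:: l]); exists p.
Qed.

Lemma christoffel_continuous c p (i j k : 'I_n) : atlas c -> chart_dom c p ->
  christoffel c y i j k @[y --> chart_map c p] --> christoffel c (chart_map c p) i j k.
Proof.
move=> ac cp; rewrite /christoffel.
apply: (@cvgM _ _ (nbhs (chart_map c p)) _ (fun=> 2^-1)); first exact: cvg_cst.
apply: (@cvg_big R _ +%R 0); [exact: add_continuous|move=> l _].
apply: cvgM.
  apply: cvg_invmx; last 2 first.
  - exact: gram_unit.
  - have := near_chart_img riemM ac cp.
    by apply: filterS => y [q cq <-]; exact: gram_unit.
  - move=> i' j'.
    exact: (differentiable_continuous (gram_differentiable riemM i' j' ac cp)).
apply: cvgB; first apply: cvgD.
- exact: partial_gram_continuous.
- exact: partial_gram_continuous.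
- exact: partial_gram_continuous.
Qed.

(** Continuity of the Christoffel symbols at the base point, phrased on the
    bilinear map so that no coordinates appear in the estimates. *)
Lemma christoffel_map_near c p : atlas c -> chart_dom c p ->
  exists2 K, 0 <= K &
  (forall u v, `|christoffel_map c (chart_map c p) u v| <= K * `|u| * `|v|) /\
  forall e, 0 < e -> \forall y \near chart_map c p, forall u v,
    `|christoffel_map c y u v - christoffel_map c (chart_map c p) u v| <=
    e * `|u| * `|v|.
Proof.
move=> ac cp; set x := chart_map c p.
pose K0 := \sum_i \sum_j \sum_k `|christoffel c x i j k|.
have K0p : 0 <= K0 by do 3 (apply: sumr_ge0 => ? _).
exists (n%:R ^+ 2 * K0); first by rewrite mulr_ge0// exprn_ge0.
split=> [u v|e e0].
  apply: tensor_bound => // i j k.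
  rewrite /K0 (bigD1 i)//= (bigD1 j)//= (bigD1 k)//= -!addrA lerDl !addr_ge0//.
  - by apply: sumr_ge0 => ? _.
  - by do 2 (apply: sumr_ge0 => ? _).
  - by do 3 (apply: sumr_ge0 => ? _).
pose e1 := e / (n%:R ^+ 2 + 1).
have n0 : 0 < n%:R ^+ 2 + 1 :> R by rewrite ltr_wpDl// exprn_ge0.
have e10 : 0 < e1 by rewrite divr_gt0.
pose Q (ijk : 'I_n * 'I_n * 'I_n) (y : 'rV[R]_n) : Prop :=
  `|christoffel c y ijk.1.1 ijk.1.2 ijk.2 -
    christoffel c x ijk.1.1 ijk.1.2 ijk.2| <= e1.
have H : \forall y \near x, forall ijk, Q ijk y.
  apply: (@filter_forall _ _ Q (nbhs x)) => -[[i j] k]; rewrite /Q /=.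
  have /cvgrPdist_le /(_ e1 e10) := @christoffel_continuous c p i j k ac cp.
  move=> H0; refine (filterS _ H0) => y.
  have E := distrC (christoffel c x i j k) (christoffel c y i j k).
  by move=> H; exact: (eq_ind _ (fun b => b <= e1) H _ E).
apply: filterS H => y H u v.
have -> : christoffel_map c y u v - christoffel_map c x u v =
  tensor (fun i j k => christoffel c y i j k - christoffel c x i j k) u v.
  by rewrite tensorB.
apply: le_trans (tensor_bound _ _ (ltW e10) _) _.
  by move=> i j k; exact: (H (i, j, k)).
rewrite !ler_wpM2r// /e1 mulrA ler_pdivrMr// mulrC ler_pM2l//.
by rewrite lerDl.
Qed.
End ChristoffelContinuity.

(** * A priori estimates for geodesics *)

(** Continuous induction on the unit interval: at the infimum of the failures
    the property holds by the second hypothesis, hence beyond it by the third. *)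
Lemma real_induction (R : realType) (P : R -> Prop) :
  P 0 ->
  (forall t, 0 < t -> t <= 1 -> (forall s, 0 <= s < t -> P s) -> P t) ->
  (forall t, 0 <= t -> P t -> \forall s \near t, P s) ->
  forall t, 0 <= t <= 1 -> P t.
Proof.
move=> P0 Pcl Pop t t01; apply: contrapT => nPt.
pose E : set R := [set s | 0 <= s <= 1 /\ ~ P s].
have Et : E t by [].
have Elb : has_lbound E by exists 0 => s [/andP[]].
pose m := inf E.
have m0 : 0 <= m by apply: lb_le_inf; [exists t|move=> s [/andP[]]].
have mt : m <= t by exact: ge_inf.
have t1 : t <= 1 by case/andP: t01.
have Pm s : 0 <= s < m -> P s.
  move=> /andP[s0 sm]; apply: contrapT => nPs.
  have : m <= s.
    apply: ge_inf => //; split => //; rewrite s0 /=.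
    exact: le_trans (ltW sm) (le_trans mt t1).
  by rewrite leNgt sm.
have {}Pm' : P m.
  move: m0; rewrite le_eqVlt => /orP[/eqP <-//|m0].
  exact: Pcl m0 (le_trans mt t1) Pm.
have /nbhs_ballP[e /= e0 eP] := Pop m m0 Pm'.
have [x Ex xm] := inf_adherent e0 (conj (ex_intro _ t Et) Elb).
have mx : m <= x by exact: ge_inf.
case: Ex => _; apply; apply: eP; rewrite -ball_normE /= distrC.
by rewrite ger0_norm ?subr_ge0// ltrBlDl.
Qed.

Section APriori.
Variables (R : realType) (n : nat) (M : riemannian_data R n).
Hypothesis riemM : riemannian_manifold M.
Variables (c : chart R M n) (x0 : 'rV[R]_n) (r K : R).
Hypothesis ac : atlas c.
Hypothesis ball_img : forall y, `|y - x0| <= r -> chart_img c y.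
Hypothesis K0 : 0 <= K.
Hypothesis christoffel_bound : forall y u v, `|y - x0| <= r ->
  `|christoffel_map c y u v| <= K * `|u| * `|v|.
Variable a : R -> M.
Hypothesis ga : geodesic setT a.
Let z := chart_map c \o a.
Let z' := derive_on setT z.
Let v := z' 0.
Hypothesis a0 : chart_dom c (a 0).
Hypothesis v0 : v != 0.
Hypothesis start : `|z 0 - x0| + 2 * `|v| < r.
Hypothesis slow : 4 * K * `|v| < 1.

Let sa : smooth_curve setT a := proj1 ga.

Let zder t : chart_dom c (a t) -> has_deriv setT z t (z' t).
Proof. exact: (curve_chart_deriv sa ac Logic.I). Qed.

Let z'der t : chart_dom c (a t) ->
  has_deriv setT z' t (- christoffel_map c (z t) (z' t) (z' t)).
Proof.
move=> ct.
exact: (geodesic_equation riemM (nondegenerate_setT R) sa ac Logic.I ct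
  (proj2 ga t Logic.I)).
Qed.

Let good t := [/\ chart_dom c (a t), `|z t - x0| < r & `|z' t| < 2 * `|v|].

Let vp : 0 < `|v|. Proof. by rewrite normr_gt0. Qed.

(** As long as the geodesic is good, its velocity is at most [2 |v|] and, by the
    geodesic equation, its acceleration at most [4 K |v|^2]; integrate each. *)
Let good_bounds t : 0 <= t <= 1 -> (forall s, 0 <= s <= t -> good s) ->
  `|z t - z 0| <= 2 * `|v| /\ `|z' t - v| <= 4 * K * `|v| ^+ 2.
Proof.
move=> /andP[t0 t1] gt; split.
- have H : `|z t - z 0| <= 2 * `|v| * (t - 0).
    apply: (mean_value_bound_rV (dg := z') t0); first by rewrite mulr_ge0.
    + by move=> s /gt[cs _ _]; exact: zder.
    + by move=> s /gt[_ _ /ltW].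
  by apply: le_trans H _; rewrite subr0 ler_piMr// mulr_ge0.
- have H : `|z' t - z' 0| <= 4 * K * `|v| ^+ 2 * (t - 0).
    apply: (mean_value_bound_rV
      (dg := fun t => - christoffel_map c (z t) (z' t) (z' t)) t0).
    + by rewrite !mulr_ge0// exprn_ge0.
    + by move=> s /gt[cs _ _]; exact: z'der.
    + move=> s /gt[cs zs vs]; rewrite normrN.
      apply: le_trans (christoffel_bound _ _ (ltW zs)) _.
      rewrite -mulrA [4 * K]mulrC -mulrA ler_wpM2l//.
      have -> : 4 * `|v| ^+ 2 = (2 * `|v|) * (2 * `|v|) by ring.
      by apply: ler_pM; [exact: normr_ge0|exact: normr_ge0|exact: ltW|exact: ltW].
  by apply: le_trans H _; rewrite subr0 ler_piMr// !mulr_ge0// exprn_ge0.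
Qed.

Let acont t : {for t, continuous a}.
Proof.
have [ca _] := sa => P Pn.
have := ca t P Pn.
have E : nbhs (t : subspace setT) = nbhs t.
  have <- : within setT (nbhs t) = nbhs t by exact: withinET.
  by rewrite (nbhs_subspace_in _).
by rewrite /fmap /= nbhs_filterE /= E.
Qed.

Let q := `|z 0 - x0| + 2 * `|v|.
Let Kset := chart_inv c @` [set y | `|y - x0| <= q].

(** The preimage under the chart of a closed ball is compact, hence closed in a
    Hausdorff space; a curve that stays in it cannot leave the chart domain in
    the limit. *)
Let Kset_closed : closed Kset.
Proof.
apply: compact_closed; first by case: riemM => -[].
apply: continuous_compact.
  apply: continuous_in_subspaceT => y; rewrite inE /= => yq.
  apply: (chart_inv_continuous riemM ac); apply: ball_img.
  exact: le_trans yq (ltW start).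
apply: bounded_closed_compact.
  exists (`|x0| + q); split; first exact: num_real.
  move=> m qm y /= yq; apply: le_trans (ltW qm).
  rewrite -[y](subrK x0) addrC; apply: le_trans (ler_normD _ _) _.
  by rewrite lerD2l.
have -> : [set y | `|y - x0| <= q] = closed_ball_ (fun w : 'rV[R]_n => `|w|) x0 q.
  by apply/seteqP; split => y /=; rewrite distrC.
exact: closed_closed_ball_.
Qed.

(** The bounds before time [t] are stronger than goodness, by [start] and
    [slow], and survive the passage to the limit. *)
Let good_closed t : 0 < t -> t <= 1 -> (forall s, 0 <= s < t -> good s) -> good t.
Proof.
move=> t0 t1 gt.
have gb s : 0 <= s < t ->
    `|z s - z 0| <= 2 * `|v| /\ `|z' s - v| <= 4 * K * `|v| ^+ 2.
  move=> /andP[s0 st]; apply: good_bounds; first by rewrite s0 ltW// (lt_le_trans st).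
  by move=> k /andP[k0 ks]; apply: gt; rewrite k0 (le_lt_trans ks).
have aK s : 0 <= s < t -> Kset (a s).
  move=> st; have [cs _ _] := gt s st; exists (z s); last exact: chart_mapK.
  rewrite /= -[z s](subrK (z 0)) -addrA /q addrC; apply: le_trans (ler_normD _ _) _.
  by rewrite lerD2l; case: (gb s st).
have approach (P : R -> Prop) : (\forall s \near t, P s) -> exists2 s, 0 <= s < t & P s.
  move=> /nbhs_ballP[e /= e0 eP].
  (* A point to the left of [t], close to it, and still nonnegative. *)
  have h : Num.max 0 (t - e / 2) < t by rewrite gt_max t0/= gtrBl divr_gt0.
  exists (Num.max 0 (t - e / 2)); first by rewrite h le_max lexx.
  apply: eP; rewrite -ball_normE /= gtr0_norm ?subr_gt0//.
  by rewrite ltrBlDr -ltrBlDl lt_max; apply/orP; right; rewrite ltrD2l ltrN2; lra.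
have [y yq yat] : Kset (a t).
  apply: contrapT => nK.
  have : \forall p \near a t, ~ Kset p.
    by apply: open_nbhs_nbhs; split => //; exact: closed_openC Kset_closed.
  move=> /acont/approach[s st]; apply; exact: aK.
have iy : chart_img c y by apply: ball_img; exact: le_trans yq (ltW start).
have ct : chart_dom c (a t) by rewrite -yat; exact: chart_dom_inv.
have zty : z t = y by rewrite /z /= -yat chart_invK.
split; [exact: ct|by rewrite zty (le_lt_trans yq)|].
have z'c := has_deriv_setT_continuous (z'der ct).
have : `|z' t - v| <= 4 * K * `|v| ^+ 2.
  apply/ler_addgt0Pl => e e0.
  have /approach[s st es] : \forall s \near t, `|z' t - z' s| <= e.
    by move/cvgrPdist_le : z'c; apply.
  rewrite -[z' t](subrK (z' s)) -addrA; apply: le_trans (ler_normD _ _) _.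
  by rewrite lerD//; case: (gb s st).
move=> H; rewrite -[z' t](subrK v); apply: le_lt_trans (ler_normD _ _) _.
have : 4 * K * `|v| ^+ 2 < `|v|.
  by rewrite expr2 mulrA -[ltRHS]mul1r ltr_pM2r.
by move: H; lra.
Qed.

Let good_open t : 0 <= t -> good t -> \forall s \near t, good s.
Proof.
move=> _ [ct zt z't].
have zc := has_deriv_setT_continuous (zder ct).
have z'c := has_deriv_setT_continuous (z'der ct).
have H1 : \forall s \near t, chart_dom c (a s).
  exact: (acont (near_chart_dom riemM ac ct)).
have H2 : \forall s \near t, `|z s - x0| < r.
  have e0 : 0 < r - `|z t - x0| by rewrite subr_gt0.
  move/cvgrPdist_lt : zc => /(_ _ e0); apply: filterS => s.
  rewrite ltrBrDr distrC; apply: le_lt_trans.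
  by have := ler_normD (z s - z t) (z t - x0); rewrite addrA subrK.
have H3 : \forall s \near t, `|z' s| < 2 * `|v|.
  have e0 : 0 < 2 * `|v| - `|z' t| by rewrite subr_gt0.
  move/cvgrPdist_lt : z'c => /(_ _ e0); apply: filterS => s.
  rewrite ltrBrDr distrC; apply: le_lt_trans.
  by have := ler_normD (z' s - z' t) (z' t); rewrite subrK.
by apply: filterS3 H1 H2 H3 => s; split.
Qed.

(** A geodesic that starts near [x0] with small velocity stays in the chart for
    unit time, with velocity close to the initial one.  Neither the chart domain
    nor the bound on the velocity is known in advance, so both are propagated
    together by [real_induction]. *)
Lemma geodesic_a_priori t : 0 <= t <= 1 ->
  [/\ chart_dom c (a t), `|z t - x0| < r, `|z' t| < 2 * `|v|,
      `|z t - z 0| <= 2 * `|v| & `|z' t - v| <= 4 * K * `|v| ^+ 2].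
Proof.
have G : forall t, 0 <= t <= 1 -> good t.
  apply: real_induction good_closed good_open.
  split => //; last by rewrite -/v ltr_pMl// ltr1n.
  by apply: le_lt_trans start; rewrite lerDl mulr_ge0.
move=> t01; have [ct zt z't] := G t t01; split => //.
  apply: (good_bounds t01 _).1 => s /andP[s0 st]; apply: G; rewrite s0.
  by case/andP: t01 => _; exact: le_trans.
apply: (good_bounds t01 _).2 => s /andP[s0 st]; apply: G; rewrite s0.
by case/andP: t01 => _; exact: le_trans.
Qed.

(** The acceleration differs from [- G0 v v] by at most the right-hand side;
    integrate twice over the unit interval. *)
Lemma geodesic_endpoint (G0 : 'rV[R]_n -> 'rV[R]_n -> 'rV[R]_n) (e : R) :
  (forall u w w', G0 (u + w) w' = G0 u w' + G0 w w') ->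
  (forall u w, G0 u w = G0 w u) ->
  (forall u w, `|G0 u w| <= K * `|u| * `|w|) ->
  (forall y u w, `|y - x0| <= r ->
     `|christoffel_map c y u w - G0 u w| <= e * `|u| * `|w|) ->
  0 <= e ->
  `|z 1 - z 0 - v + 2^-1 *: G0 v v| <= (4 * e + 12 * K ^+ 2 * `|v|) * `|v| ^+ 2.
Proof.
move=> GD GC GB Gc e0.
set E := _ * `|v| ^+ 2.
have v2 : 0 <= `|v| ^+ 2 by rewrite exprn_ge0.
have E0 : 0 <= E by rewrite mulr_ge0// addr_ge0// !mulr_ge0// exprn_ge0.
have EE : 4 * e * `|v| ^+ 2 +
    (8 * K ^+ 2 * `|v| * `|v| ^+ 2 + 4 * K ^+ 2 * `|v| * `|v| ^+ 2) = E.
  by rewrite /E; ring.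
have mul3 (A B C D F : R) : 0 <= A -> 0 <= B -> 0 <= C -> B <= D -> C <= F ->
    A * B * C <= A * D * F.
  by move=> A0 B0 C0 BD CF; rewrite ler_pM// ?mulr_ge0// ler_wpM2l.
have acc t : 0 <= t <= 1 -> `|- christoffel_map c (z t) (z' t) (z' t) + G0 v v| <= E.
  move=> /geodesic_a_priori[_ zt z't _ zv].
  rewrite addrC distrC.
  have -> : christoffel_map c (z t) (z' t) (z' t) - G0 v v =
    (christoffel_map c (z t) (z' t) (z' t) - G0 (z' t) (z' t)) +
    (G0 (z' t - v) (z' t) + G0 (z' t - v) v).
    have -> : G0 (z' t - v) (z' t) + G0 (z' t - v) v = G0 (z' t) (z' t) - G0 v v.
      have GN u w : G0 (- u) w = - G0 u w.
        have G00 : G0 0 w = 0 by apply: (@addrI _ (G0 0 w)); rewrite -GD !addr0.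
        by apply/eqP; rewrite -addr_eq0 -GD addNr G00.
      by rewrite (GD _ _ (z' t)) (GD _ _ v) !GN (GC v (z' t)) addrA subrK.
    by rewrite addrA subrK.
  apply: le_trans (ler_normD _ _) _.
  have z'2 := ltW z't.
  have H1 : `|christoffel_map c (z t) (z' t) (z' t) - G0 (z' t) (z' t)| <=
      4 * e * `|v| ^+ 2.
    apply: le_trans (Gc _ _ _ (ltW zt)) _.
    rewrite (_ : 4 * e * `|v| ^+ 2 = e * (2 * `|v|) * (2 * `|v|)); last by ring.
    by apply: mul3; [exact: e0|exact: normr_ge0|exact: normr_ge0|..].
  have H2 : `|G0 (z' t - v) (z' t)| <= 8 * K ^+ 2 * `|v| * `|v| ^+ 2.
    apply: le_trans (GB _ _) _.
    rewrite (_ : 8 * K ^+ 2 * `|v| * `|v| ^+ 2 =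
       K * (4 * K * `|v| ^+ 2) * (2 * `|v|)); last by ring.
    by apply: mul3; [exact: K0|exact: normr_ge0|exact: normr_ge0|..].
  have H3 : `|G0 (z' t - v) v| <= 4 * K ^+ 2 * `|v| * `|v| ^+ 2.
    apply: le_trans (GB _ _) _.
    rewrite (_ : 4 * K ^+ 2 * `|v| * `|v| ^+ 2 =
       K * (4 * K * `|v| ^+ 2) * `|v|); last by ring.
    by apply: mul3; [exact: K0|exact: normr_ge0|exact: normr_ge0|exact: zv|].
  apply: le_trans (lerD H1 (le_trans (ler_normD _ _) (lerD H2 H3))) _.
  by rewrite EE lexx.
have hlin (w : 'rV[R]_n) (t : R) : has_deriv setT (fun t : R => t *: w) t w.
  have -> : (fun t : R => t *: w) = fun t => 0 + t *: w.
    by apply/funext => s; rewrite add0r.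
  exact: has_deriv_line.
(* [g 1] is the quantity to bound, up to [z 0], and [g'] is its derivative. *)
pose g' t := z' t - v + t *: G0 v v.
pose g t := z t - t *: v + t *: (t *: (2^-1 *: G0 v v)).
have g'0 : g' 0 = 0 by rewrite /g' subrr scale0r addr0.
have g'b t : 0 <= t <= 1 -> `|g' t| <= E.
  move=> /andP[t0 t1].
  have H : `|g' t - g' 0| <= E * (t - 0).
    apply: (mean_value_bound_rV
      (dg := fun t => - christoffel_map c (z t) (z' t) (z' t) + G0 v v) t0) => //.
      move=> s /andP[s0 st].
      have s01 : 0 <= s <= 1 by rewrite s0 (le_trans st).
      have [cs _ _ _ _] := geodesic_a_priori s01.
      apply: has_derivD; last exact: hlin.
      rewrite -[X in has_deriv _ _ _ X]addr0.
      apply: (has_derivD (v := fun=> - v)); last exact: has_deriv_cst.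
      exact: z'der.
    by move=> s /andP[s0 st]; apply: acc; rewrite s0 (le_trans st).
  rewrite g'0 !subr0 in H.
  by apply: le_trans H _; rewrite ler_piMr.
have H : `|g 1 - g 0| <= E * (1 - 0).
  apply: (mean_value_bound_rV (dg := g') ler01) => // t t01.
  have [ct _ _ _ _] := geodesic_a_priori t01.
  apply: has_derivD.
    apply: has_derivD; first exact: zder.
    by apply: has_derivN.
  have -> : t *: G0 v v = 1 *: (t *: (2^-1 *: G0 v v)) + t *: (2^-1 *: G0 v v).
    rewrite scale1r -scalerDr; congr (_ *: _).
    by rewrite -scalerDl -[LHS]scale1r; congr (_ *: _); field.
  apply: (has_derivZ (u := fun t => t)); last exact: hlin.
  have -> : (fun t : R => t : R^o) = fun t : R => 0 + t *: (1 : R^o).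
    by apply/funext => s; rewrite add0r /GRing.scale /= mulr1.
  exact: has_deriv_line.
rewrite subr0 mulr1 in H; apply: le_trans H.
by rewrite /g !scale1r !scale0r subr0 addr0 (addrAC (z 1)) [X in _ <= `|X|]addrAC.
Qed.

End APriori.

(** * Affine functions in a chart *)

Section Parallel.
Variables (R : realType) (n : nat) (M : riemannian_data R n).
Hypothesis riemM : riemannian_manifold M.
Hypothesis complM : complete_manifold M.
Variable f : M -> R^o.
Hypothesis fA : affine_fun f.
Hypothesis fD : differentiable_fun f.

Lemma chart_fun_differentiable (c : chart R M n) p : atlas c -> chart_dom c p ->
  differentiable (f \o chart_inv c) (chart_map c p).
Proof.
move=> ac cp.
exact: (change_chart riemM
  ac (chart_at_atlas riemM p) cp (chart_at_dom riemM p) (fD p)).1.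
Qed.

Lemma geodesic_from_chart (c : chart R M n) q (v : 'rV[R]_n) :
  atlas c -> chart_dom c q ->
  exists a : R -> M, [/\ geodesic setT a, a 0 = q &
    derive_on setT (chart_map c \o a) 0 = v].
Proof.
move=> ac cq.
have [a [ga a0 va]] :=
  complM (p := q) ('d (transition c (chart_at q)) (chart_map c q) v : 'rV[R]_n).
exists a; split => //.
have c0 : chart_dom c (a 0) by rewrite a0.
rewrite -(components_velocity riemM (nondegenerate_setT R) (proj1 ga) ac Logic.I c0).
rewrite va /components /coord_at a0.
exact: (transitionK riemM v ac (chart_at_atlas riemM q) cq (chart_at_dom riemM q)).
Qed.

(** [f] is [u t + b] along the geodesic, and the chain rule at time 0 identifies
    the slope [u] with the differential of [f] at the initial velocity. *)
Lemma affine_along_geodesic (c : chart R M n) (a : R -> M) : atlas c ->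
  geodesic setT a -> chart_dom c (a 0) -> chart_dom c (a 1) ->
  (f \o chart_inv c) (chart_map c (a 1)) =
  (f \o chart_inv c) (chart_map c (a 0)) +
  'd (f \o chart_inv c) (chart_map c (a 0)) (derive_on setT (chart_map c \o a) 0).
Proof.
move=> ac ga c0 c1.
have [u [b fa]] := fA (nondegenerate_setT R) ga.
rewrite /= (chart_mapK riemM ac c0) (chart_mapK riemM ac c1) !fa//.
have H1 := curve_chart_deriv (proj1 ga) ac Logic.I c0.
have H2 := has_deriv_comp H1 (chart_fun_differentiable ac c0).
have H3 : has_deriv setT (fun t => b + t *: (u : R^o) : R^o) 0 u.
  exact: has_deriv_line.
have H4 : has_deriv setT ((f \o chart_inv c) \o (chart_map c \o a)) 0 u.
  apply: has_deriv_ext H3.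
    by rewrite scale0r addr0 /= (chart_mapK riemM ac c0) fa// mulr0 add0r.
  have := curve_near_chart riemM (proj1 ga) ac Logic.I c0.
  apply: filterS => t ct _; rewrite /= (chart_mapK riemM ac (ct Logic.I)) fa//.
  by rewrite addrC mulrC.
rewrite (has_deriv_unique H2 H4) mulr0 add0r mulr1 addrC.
by [].
Qed.

(** The hypothesis of [geodesically_affine_hessian]: the endpoint is that of the
    geodesic with initial point [x] and initial velocity [v] in the chart. *)
Lemma affine_geodesic_expansion (c : chart R M n) p : atlas c -> chart_dom c p ->
  forall e, 0 < e -> exists2 d, 0 < d &
  forall x v, `|x - chart_map c p| < d -> `|v| < d -> exists2 z,
    `|z - x - v + 2^-1 *: christoffel_map c (chart_map c p) v v| <= e * `|v| ^+ 2 &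
    (f \o chart_inv c) z = (f \o chart_inv c) x + 'd (f \o chart_inv c) x v.
Proof.
move=> ac cp e e0; set x0 := chart_map c p.
have [K K0 [HK Hc]] := christoffel_map_near riemM ac cp; rewrite -/x0 in HK Hc.
(* The error of [geodesic_endpoint] is [4 eta + 12 K1^2 |v|]. *)
pose eta := Num.min 1 (e / 8).
have eta0 : 0 < eta by rewrite lt_min ltr01 divr_gt0.
have eta1 : eta <= 1 by rewrite ge_min lexx.
have etae : eta <= e / 8 by rewrite ge_min lexx orbT.
have /nbhs_ballP[r0 /= r00 rH] : \forall y \near x0, chart_img c y /\
    forall u v,
      `|christoffel_map c y u v - christoffel_map c x0 u v| <= eta * `|u| * `|v|.
  by apply: filterI; [exact: near_chart_img|exact: Hc].
pose r := r0 / 2; have r_gt0 : 0 < r by rewrite divr_gt0.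
have {}rH y : `|y - x0| <= r -> chart_img c y /\
    forall u v,
      `|christoffel_map c y u v - christoffel_map c x0 u v| <= eta * `|u| * `|v|.
  move=> yr; apply: rH; rewrite -ball_normE /= distrC.
  by apply: le_lt_trans yr _; rewrite /r; move: r00; lra.
have ball_img y : `|y - x0| <= r -> chart_img c y by move=> /rH[].
(* A bound valid on the whole ball, as [eta <= 1]. *)
pose K1 := K + 1.
have K10 : 0 < K1 by rewrite ltr_wpDl.
have HK1 u v : `|christoffel_map c x0 u v| <= K1 * `|u| * `|v|.
  by apply: le_trans (HK u v) _; rewrite !ler_wpM2r// lerDl.
have HK2 y u v : `|y - x0| <= r -> `|christoffel_map c y u v| <= K1 * `|u| * `|v|.
  move=> /rH[_ /(_ u v) H].
  rewrite -[christoffel_map c y u v](subrK (christoffel_map c x0 u v)).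
  apply: le_trans (ler_normD _ _) _; rewrite /K1 mulrDl mulrDl addrC.
  rewrite lerD//; apply: le_trans H _.
  by rewrite !ler_wpM2r.
(* The first bound keeps the geodesic in the ball, the second is the smallness
   required by the a priori estimate, the third absorbs the cubic error. *)
pose d := Num.min (r / 4) (Num.min ((4 * K1)^-1) (e / 2 / (12 * K1 ^+ 2))).
have K12 : 0 < 12 * K1 ^+ 2 by rewrite mulr_gt0// exprn_gt0.
have K14 : 0 < 4 * K1 by rewrite mulr_gt0.
have d0 : 0 < d by rewrite !lt_min !divr_gt0// invr_gt0 K14.
exists d => // x v xd vd.
have xr : `|x - x0| < r / 4 by apply: lt_le_trans xd _; rewrite !ge_min lexx.
have vr : `|v| < r / 4 by apply: lt_le_trans vd _; rewrite !ge_min lexx.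
have vK : 4 * K1 * `|v| < 1.
  rewrite mulrC -ltr_pdivlMr// mul1r.
  by apply: lt_le_trans vd _; rewrite !ge_min lexx !orbT.
have vK2 : 12 * K1 ^+ 2 * `|v| <= e / 2.
  rewrite mulrC -ler_pdivlMr//.
  by apply: le_trans (ltW vd) _; rewrite !ge_min lexx !orbT.
have [->|v0] := eqVneq v 0.
  exists x; last by rewrite linear0 addr0.
  have := christoffel_mapZl c x0 0 0 0; rewrite !scale0r => ->.
  by rewrite subrr subr0 scaler0 addr0 !normr0 mulr_ge0// ltW.
have ix : chart_img c x.
  by apply: ball_img; apply: le_trans (ltW xr) _; move: r_gt0; lra.
have cq := chart_dom_inv riemM ac ix.
have xE := chart_invK riemM ac ix.
have [a [ga a0 va]] := geodesic_from_chart v ac cq.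
have za0 : (chart_map c \o a) 0 = x by rewrite /= a0.
have c0 : chart_dom c (a 0) by rewrite a0.
have v0' : derive_on setT (chart_map c \o a) 0 != 0 by rewrite va.
have start : `|(chart_map c \o a) 0 - x0| +
    2 * `|derive_on setT (chart_map c \o a) 0| < r.
  by rewrite za0 va; move: xr vr r_gt0; lra.
have slow : 4 * K1 * `|derive_on setT (chart_map c \o a) 0| < 1 by rewrite va.
have [|c1 _ _ _ _] :=
  geodesic_a_priori riemM ac ball_img (ltW K10) HK2 ga c0 v0' start slow (t := 1).
  by rewrite ler01 lexx.
have E := geodesic_endpoint riemM ac ball_img (ltW K10) HK2 ga c0 v0' start slow
  (christoffel_mapDl c x0) (fun u w => christoffel_map_sym riemM u w ac cp) HK1
  (fun y u w yr => (rH y yr).2 u w) (ltW eta0).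
exists (chart_map c (a 1)).
  move: E; rewrite va za0 => E; apply: le_trans E _.
  rewrite ler_wpM2r ?exprn_ge0//.
  by move: vK2 etae; lra.
have := affine_along_geodesic ac ga c0 c1.
by rewrite va [chart_map c (a 0)]za0.
Qed.

End Parallel.

(** * The gradient of an affine function is parallel *)

Section ParallelGradient.
Variables (R : realType) (n : nat) (M : riemannian_data R n).
Hypothesis riemM : riemannian_manifold M.
Hypothesis complM : complete_manifold M.
Variable f : M -> R^o.
Hypothesis fA : affine_fun f.
Hypothesis fD : differentiable_fun f.

(** In coordinates, the second covariant derivative of an affine function
    vanishes. *)
Lemma affine_hessian (c : chart R M n) p w : atlas c -> chart_dom c p ->
  let F := f \o chart_inv c in let x0 := chart_map c p in
  differentiable (fun x => 'd F x w : R^o) x0 /\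
  forall h, 'd (fun x => 'd F x w : R^o) x0 h = 'd F x0 (christoffel_map c x0 h w).
Proof.
move=> ac cp F x0.
have [K K0 [HK _]] := christoffel_map_near riemM ac cp; rewrite -/x0 in HK.
have /nbhs_ballP[rho /= rho0 rhoH] := near_chart_img riemM ac cp.
have FD x : `|x - x0| < rho -> differentiable F x.
  move=> xr; have [q cq <-] : chart_img c x.
    by apply: rhoH; rewrite -ball_normE /= distrC.
  exact: (chart_fun_differentiable riemM fD ac cq).
have H := geodesically_affine_hessian rho0 K0 FD
  (christoffel_mapDl c x0) (christoffel_mapZl c x0)
  (fun u v => christoffel_map_sym riemM u v ac cp) HK
  (affine_geodesic_expansion riemM complM fA fD ac cp).
have F0 : differentiable F x0 by apply: FD; rewrite subrr normr0.
pose L (h : 'rV[R]_n) : R^o := 'd F x0 (christoffel_map c x0 h w).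
have Llin : linear L.
  move=> k u v; rewrite /L (christoffel_mapDl c x0 (k *: u)) christoffel_mapZl.
  by rewrite (linearD ('d F x0)) (linearZZ ('d F x0)).
pose LM := GRing.isLinear.Build _ _ _ _ _ Llin.
pose L' : {linear 'rV[R]_n -> R^o} := HB.pack L LM.
have [k k0 kF] := linear_lipschitz (diff_continuous F0).
have L'c : continuous L'.
  apply: bounded_linear_continuous; apply/linear_boundedP.
  exists (k * K * `|w|); split; first exact: num_real.
  move=> m mk x /=; apply: le_trans (kF _) _.
  apply: le_trans (_ : k * K * `|w| * `|x| <= _); last by rewrite ler_wpM2r// ltW.
  rewrite -!mulrA ler_pM2l// [`|w| * _]mulrC mulrA; exact: HK.
have [D E] : differentiable (fun x => 'd F x w : R^o) x0 /\
    'd (fun x => 'd F x w : R^o) x0 = L' :> ('rV[R]_n -> R^o).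
  apply: differential_char L'c _ => e e0.
  have e10 : 0 < e / (`|w| + 1) by rewrite divr_gt0// ltr_wpDl.
  have [d d0 Hd] := H _ e10.
  apply: filterS (nbhsx_ballx x0 _ d0) => y; rewrite -ball_normE /= distrC => yd.
  have := Hd (y - x0) w yd; rewrite [x0 + _]addrC subrK => H1.
  apply: le_trans H1 _; rewrite mulrAC ler_wpM2r//.
  by rewrite mulrAC ler_pdivrMr ?ltr_wpDl// ler_wpM2l ?(ltW e0)// lerDl.
split; first exact: D.
by move=> h; exact: (congr1 (fun T : 'rV[R]_n -> R^o => T h) E).
Qed.

Lemma differential_chart (c : chart R M n) p (v : tangent p) :
  atlas c -> chart_dom c p ->
  differential f v = 'd (f \o chart_inv c) (chart_map c p) (components c v).
Proof.
move=> ac cp.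
have D := chart_fun_differentiable riemM fD ac cp.
exact: ((change_chart riemM
  (chart_at_atlas riemM p) ac (chart_at_dom riemM p) cp D).2 v).
Qed.

(** Differentiating [dF_y w] along the curve gives [dF_y w'] plus the derivative
    of [dF] in the direction of the velocity, which by [affine_hessian] is [dF] of
    the Christoffel term of the covariant derivative. *)
Lemma affine_differential_along (I : set R) (a : R -> M) (V : field_along a) s :
  nondegenerate_interval I -> smooth_curve I a -> smooth_field I V -> I s ->
  has_deriv I (fun t => differential f (V t) : R^o) s
    (differential f (cov_derive I V s)).
Proof.
move=> nI sa sV Is.
set c := chart_at (a s).
have ac : atlas c := chart_at_atlas riemM (a s).
have cs : chart_dom c (a s) := chart_at_dom riemM (a s).
pose F := f \o chart_inv c.
pose y := chart_map c \o a; pose w t : 'rV[R]_n := components c (V t).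
have hy : has_deriv I y s (derive_on I y s) by exact: curve_chart_deriv.
have hw : has_deriv I w s (derive_on I w s) by exact: (sV c ac 0%N s Is cs).
have HF u := affine_hessian u ac cs.
have H := has_deriv_differential hy hw (fun u => (HF u).1).
have E : 'd (fun x => 'd F x (w s) : R^o) (y s) (derive_on I y s) +
    'd F (y s) (derive_on I w s) = differential f (cov_derive I V s).
  rewrite [X in X + _](HF (w s)).2 addrC -(linearD ('d F (y s))).
  by [].
rewrite -E; apply: has_deriv_ext H.
  by apply/esym; exact: differential_chart.
apply: filterS (curve_near_chart riemM sa ac Is cs) => t ct It.
by apply/esym; exact: (differential_chart (V t) ac (ct It)).
Qed.

End ParallelGradient.

(** * The Frenet recursion *)

Section Recursion.
Variables (R : realType) (I : set R) (n : nat) (c : R).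
Variables (k e : nat -> R -> R^o).
Hypothesis nI : nondegenerate_interval I.
Hypothesis n3 : (3 <= n)%N.
Hypothesis c0 : c != 0.
Hypothesis kpos : forall i s, (1 <= i <= n.-1)%N -> I s -> 0 < k i s.
Hypothesis e1 : forall s, I s -> e 1%N s = c.
Hypothesis frenet : forall i s, (1 <= i <= n)%N -> I s ->
  has_deriv I (e i) s ((if i == 1%N then 0 else - (k i.-1 s * e i.-1 s)) +
    (if i == n then 0 else k i s * e i.+1 s)).

Let const_deriv i b s : (1 <= i < n)%N -> I s -> (forall t, I t -> e i t = b) ->
  (if i == 1%N then 0 else - (k i.-1 s * e i.-1 s)) + k i s * e i.+1 s = 0.
Proof.
move=> /andP[i1 iN] Is eb.
have H := frenet (introT andP (conj i1 (ltnW iN))) Is.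
rewrite (ltn_eqF iN) in H.
rewrite -(derive_on_unique nI Is H).
apply: (derive_on_unique nI Is).
apply: has_deriv_ext (has_deriv_cst I s (b : R^o)); first by rewrite eb.
by apply: (@filterE _ (nbhs s)) => t It; rewrite eb.
Qed.

(** The case [i = 0], that is [e 2 = 0], belongs to the statement because the
    recursion for the harmonic curvatures starts from [H_0 = 0]. *)
Lemma frenet_recursion i s : (i <= n - 2)%N -> I s ->
  e i.+2 s = harmonic_curvature I k i s * c.
Proof.
have [m] := ubnP i; elim: m i s => // m IH i s im iN Is.
have e2 t : I t -> e 2%N t = 0.
  move=> It; have n1 : (1 <= 1 < n)%N by lia.
  have := const_deriv n1 It e1; rewrite /= add0r => /eqP.
  rewrite mulf_eq0 gt_eqF//=; first by move=> /eqP.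
  by apply: kpos => //; lia.
case: i im iN => [|[|j]] im iN.
- by rewrite /= mul0r e2.
- have n2 : (1 <= 2 < n)%N by lia.
  have := const_deriv n2 Is e2; rewrite /= e1// => H.
  have k2 : k 2%N s != 0 by rewrite gt_eqF// kpos//; lia.
  apply: (mulfI k2); transitivity (k 1%N s * c); last by rewrite /=; field.
  by apply/eqP; rewrite -subr_eq0 addrC; apply/eqP.
have IHj1 t : I t -> e j.+3 t = harmonic_curvature I k j.+1 t * c.
  by move=> It; apply: IH => //; lia.
have IHj : e j.+2 s = harmonic_curvature I k j s * c.
  by apply: IH => //; lia.
have jn : (1 <= j.+3 <= n)%N by lia.
have H := frenet jn Is.
rewrite (_ : (j.+3 == n) = false) /= in H; last by lia.
have Hd : has_deriv I (harmonic_curvature I k j.+1 : R -> R^o) s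
    (c^-1 * (- (k j.+2 s * e j.+2 s) + k j.+3 s * e j.+4 s)).
  have := has_derivM (has_deriv_cst I s (c^-1 : R^o)) H.
  rewrite mul0r add0r; apply: has_deriv_ext.
    by rewrite IHj1// mulrCA mulVf// mulr1.
  by apply: (@filterE _ (nbhs s)) => t It; rewrite IHj1// mulrCA mulVf// mulr1.
have k3 : k j.+3 s != 0 by rewrite gt_eqF// kpos//; lia.
have -> : harmonic_curvature I k j.+2 s = (k j.+3 s)^-1 *
    (@derive_on R R^o I (harmonic_curvature I k j.+1) s +
     k j.+2 s * harmonic_curvature I k j s) by [].
rewrite (derive_on_unique nI Is Hd) IHj.
by field; rewrite k3 c0.
Qed.

End Recursion.

Theorem theorem3p1 (R : realType) (n : nat) (M : riemannian_data R n)
  (f : M -> R) (gradf : forall p : M, tangent p)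
  (I : set R) (a : R -> M) (V : nat -> field_along a) (k : nat -> R -> R) :
  (3 <= n)%N ->
  riemannian_manifold M ->
  connected [set: M] ->
  complete_manifold M ->
  (exists (m : nat) (N : riemannian_data R m),
     riemannian_manifold N /\
     isometric M (riemannian_prod N (real_line R))) ->
  affine_fun f ->
  nontrivial_fun f ->
  is_gradient f gradf ->
  nondegenerate_interval I ->
  frenet_curve I V k ->
  eikonal_helix I (V 1%N) gradf ->
  forall (i : nat) (s : R), (1 <= i <= n - 2)%N -> I s ->
    inner (V i.+2 s) (gradf (a s)) =
    harmonic_curvature I k i s * inner (V 1%N s) (gradf (a s)).
Proof.
move=> n3 riemM _ complM _ fA _ [fD grad] nI [[sa _] sV [_ _] kpos frenet].
move=> [_ [c c0 helix]].
have sym (p : M) (u v : tangent p) : inner u v = inner v u.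
  by case: riemM => _ H _ _; exact: H.
have innerE (p : M) (v : tangent p) : inner v (gradf p) = differential f v.
  by rewrite sym; apply/esym; exact: grad.
pose e i s : R^o := inner (V i s) (gradf (a s)).
have e1 s : I s -> e 1%N s = c by move=> Is; rewrite /e sym; exact: helix.
have eder i s : (1 <= i <= n)%N -> I s ->
    has_deriv I (e i) s ((if i == 1%N then 0 else - (k i.-1 s * e i.-1 s)) +
      (if i == n then 0 else k i s * e i.+1 s)).
  move=> iN Is.
  have := affine_differential_along riemM complM fA fD nI sa (sV i iN) Is.
  rewrite (frenet i s iN Is).
  have -> : differential f
      ((if i == 1%N then 0 else - k i.-1 s *: (V i.-1 s : 'rV[R]_n)) +
       (if i == n then 0 else k i s *: (V i.+1 s : 'rV[R]_n)) : tangent (a s)) =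
     (if i == 1%N then 0 else - (k i.-1 s * e i.-1 s)) +
      (if i == n then 0 else k i s * e i.+1 s).
    rewrite /differential linearD; congr (_ + _); case: ifP => _; rewrite ?linear0//.
      by rewrite linearZZ /e innerE /GRing.scale /= mulNr.
    by rewrite linearZZ /e innerE.
  apply: has_deriv_ext; first by rewrite /e innerE.
  by apply: (@filterE _ (nbhs s)) => t _; rewrite /e innerE.
move=> i s /andP[_ iN] Is.
have -> : inner (V 1%N s) (gradf (a s)) = c by exact: e1.
exact: (frenet_recursion nI n3 c0 kpos e1 eder iN Is).
Qed.
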